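(* Let $d_1,d_2\geq 2$ and let $\rho$ be an absolutely PPT state on $\mathbb{C}^{d_1}\otimes\mathbb{C}^{d_2}$. Then $\mathrm{SN}(\rho)\leq\min(d_1,d_2)-1$.
   Context: A quantum state $\rho$ on $\mathbb{C}^{d_1}\otimes\mathbb{C}^{d_2}$ is PPT if $(\mathrm{id}\otimes T)(\rho)\geq 0$, with $T$ the transposition in the computational basis; it is absolutely PPT if $U\rho U^\dagger$ is PPT for every unitary $U$ on $\mathbb{C}^{d_1}\otimes\mathbb{C}^{d_2}$. The Schmidt rank of $\ket{\psi}$ is the rank of $\mathrm{tr}_A\ket{\psi}\bra{\psi}$; $\mathrm{SN}(\rho)$ is the minimum over decompositions $\rho=\sum_ip_i\ket{\psi_i}\bra{\psi_i}$ into convex combinations of pure states of the maximal Schmidt rank of the $\ket{\psi_i}$. *)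

(* Defs.v *)
From HB Require Import structures.
From mathcomp Require Import all_boot all_order all_algebra.
From mathcomp Require Import reals.
From mathcomp.real_closed Require Import complex.

Set Implicit Arguments.
Unset Strict Implicit.
Unset Printing Implicit Defensive.

Import Order.TTheory GRing.Theory Num.Theory.
Local Open Scope ring_scope.
Local Open Scope complex_scope.

(* The space C^{d1} (x) C^{d2} is C^(d1*d2); the basis vector |i>|j> is the
   coordinate indexed by  mxvec_index i j : 'I_(d1*d2).
   Kets are column vectors 'cV_(d1*d2). *)

Section Q.
Variable R : realType.
Local Notation C := (R[i]).

Definition adj m n (A : 'M[C]_(m, n)) : 'M[C]_(n, m) :=
  \matrix_(i, j) (A j i)^*.

Definition psd n (A : 'M[C]_n) : Prop :=
  adj A = A /\ forall x : 'cV[C]_n, 0 <= (adj x *m A *m x) 0 0.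

Definition is_state n (rho : 'M[C]_n) : Prop := psd rho /\ \tr rho = 1.

Definition unitary n (U : 'M[C]_n) : Prop := U *m adj U = 1%:M.

(* partial transpose (id (x) T) on the second factor, computational basis:
   (rho^{T_B})_{(i,j),(k,l)} = rho_{(i,l),(k,j)} *)
Definition ptrans d1 d2 (rho : 'M[C]_(d1 * d2)) : 'M[C]_(d1 * d2) :=
  \matrix_(a, b)
    \sum_(i < d1) \sum_(j < d2) \sum_(k < d1) \sum_(l < d2)
      ((a == mxvec_index i j) && (b == mxvec_index k l))%:R
        * rho (mxvec_index i l) (mxvec_index k j).

Definition PPT d1 d2 (rho : 'M[C]_(d1 * d2)) : Prop := psd (ptrans rho).

Definition absolutely_PPT d1 d2 (rho : 'M[C]_(d1 * d2)) : Prop :=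
  forall U : 'M[C]_(d1 * d2), unitary U -> PPT (U *m rho *m adj U).

Definition ptraceA d1 d2 (X : 'M[C]_(d1 * d2)) : 'M[C]_d2 :=
  \matrix_(j, l) \sum_(i < d1) X (mxvec_index i j) (mxvec_index i l).

Definition proj n (psi : 'cV[C]_n) : 'M[C]_n := psi *m adj psi.

Definition schmidt_rank d1 d2 (psi : 'cV[C]_(d1 * d2)) : nat :=
  \rank (ptraceA (proj psi)).

(* SN(rho) <= m : some decomposition of rho as a (finite) convex combination
   of pure states has all Schmidt ranks <= m.  Since SN(rho) is a minimum
   over such decompositions of natural numbers, this is exactly SN(rho) <= m. *)
Definition SN_le d1 d2 (rho : 'M[C]_(d1 * d2)) (m : nat) : Prop :=
  exists (N : nat) (p : 'I_N -> R) (psi : 'I_N -> 'cV[C]_(d1 * d2)),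
    [/\ forall t, 0 <= p t,
        \sum_(t < N) p t = 1,
        forall t, (adj (psi t) *m psi t) 0 0 = 1,
        rho = \sum_(t < N) (p t)%:C *: proj (psi t)
      & forall t, (schmidt_rank (psi t) <= m)%N].

End Q.

(* Main.v *)
Require Import Defs.
From HB Require Import structures.
From mathcomp Require Import all_boot all_order all_algebra.
From mathcomp Require Import reals.
From mathcomp.real_closed Require Import complex.
From mathcomp Require Import ring lra.
From mathcomp Require Import boolp classical_sets topology normedtype trigo.

(** Let the smaller factor have dimension [n], and let [e0], [e1] be two of its
    basis vectors. It suffices to write the compression of [rho] to
    [span(e0, e1) (x) C^m] as a sum of product kets: lifting each of them along
    a Schur complement gives a decomposition of [rho] into kets whose coefficient
    matrices have two parallel rows, hence of Schmidt rank at most [n - 1].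

    Write the compression as [[A, B], [B*, D]] in an orthonormal basis of
    [span(e0, e1)]. It is a sum of product kets as soon as
    [|v*Bw|^2 <= (x*Ax)(y*Dy)] for all unit vectors [x], [y], [v], [w], since then
    [A >= a], [D >= d] and [B / sqrt(ad)] is a contraction, hence a corner of an
    average of two unitaries. Absolute positivity of the partial transpose gives
    this inequality whenever [|<x,v>| = |<y,w>|]: conjugate by a unitary sending
    [x] to [w] and [v] to [y]. In any basis the quadruples violating it form a
    connected set, so [|<x,v>| - |<y,w>|] has a constant sign on them. Rotating the
    basis by a quarter turn exchanges the roles of [(x, v)] and [(y, w)] and flips
    the sign, so by continuity some basis admits no violating quadruple. *)

Section AbsolutelyPPT.
Set Implicit Arguments.
Unset Strict Implicit.
Unset Printing Implicit Defensive.
Import Order.TTheory GRing.Theory Num.Theory numFieldNormedType.Exports.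
Local Open Scope ring_scope.
Local Open Scope sesquilinear_scope.
Local Open Scope complex_scope.
Variable R : realType.
Local Notation C := (R[i]).
Local Notation Re := (@complex.Re R).
Local Notation Im := (@complex.Im R).

(** * Adjoints and quadratic forms *)

Lemma adjE m n (A : 'M[C]_(m, n)) : adj A = A ^t*.
Proof. by apply/matrixP=> i j; rewrite !mxE. Qed.

Lemma adjK m n (A : 'M[C]_(m, n)) : adj (adj A) = A.
Proof. by apply/matrixP=> i j; rewrite !mxE conjcK. Qed.

Lemma adjM m n p (A : 'M[C]_(m, n)) (B : 'M[C]_(n, p)) :
  adj (A *m B) = adj B *m adj A.
Proof. by rewrite !adjE trmx_mul map_mxM. Qed.

Lemma adjD m n (A B : 'M[C]_(m, n)) : adj (A + B) = adj A + adj B.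
Proof. by apply/matrixP=> i j; rewrite !mxE rmorphD. Qed.

Lemma adjN m n (A : 'M[C]_(m, n)) : adj (- A) = - adj A.
Proof. by apply/matrixP=> i j; rewrite !mxE rmorphN. Qed.

Lemma adjB m n (A B : 'M[C]_(m, n)) : adj (A - B) = adj A - adj B.
Proof. by rewrite adjD adjN. Qed.

Lemma adj_scale m n (a : C) (A : 'M[C]_(m, n)) : adj (a *: A) = conjc a *: adj A.
Proof. by apply/matrixP=> i j; rewrite !mxE rmorphM. Qed.

Lemma adj0 m n : adj (0 : 'M[C]_(m, n)) = 0.
Proof. by apply/matrixP=> i j; rewrite !mxE conjc0. Qed.

Lemma adj_scalar n (a : C) : adj (a%:M : 'M[C]_n) = (conjc a)%:M.
Proof. by apply/matrixP=> i j; rewrite !mxE rmorphMn eq_sym. Qed.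

Lemma adj1 n : adj (1%:M : 'M[C]_n) = 1%:M.
Proof. by rewrite adj_scalar rmorph1. Qed.

Lemma adj_row_mx m n p (A : 'M[C]_(m, n)) (B : 'M[C]_(m, p)) :
  adj (row_mx A B) = col_mx (adj A) (adj B).
Proof. by rewrite !adjE tr_row_mx map_col_mx. Qed.

Lemma adj_col_mx m n p (A : 'M[C]_(m, n)) (B : 'M[C]_(p, n)) :
  adj (col_mx A B) = row_mx (adj A) (adj B).
Proof. by rewrite !adjE tr_col_mx map_row_mx. Qed.

Lemma adj_sum m n (I : Type) (r : seq I) (F : I -> 'M[C]_(m, n)) :
  adj (\sum_(i <- r) F i) = \sum_(i <- r) adj (F i).
Proof.
by elim/big_rec2: _ => [|i y1 y2 _ <-]; rewrite ?adj0 ?adjD.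
Qed.

Definition ip n (x y : 'cV[C]_n) : C := (adj x *m y) 0 0.
Definition sform m n (X : 'M[C]_(m, n)) (x : 'cV[C]_m) (y : 'cV[C]_n) : C :=
  ip x (X *m y).
(** Taking the real part puts inequalities between forms in the ordered field [R]; for Hermitian [X]
    nothing is lost, by [herm_qf]. *)
Definition qf n (X : 'M[C]_n) (x : 'cV[C]_n) : R := Re (sform X x x).
Definition nrm n (x : 'cV[C]_n) : R := Re (ip x x).
Definition nsq (z : C) : R := Re z ^+ 2 + Im z ^+ 2.

Lemma ipE n (x y : 'cV[C]_n) : ip x y = \sum_k conjc (x k 0) * y k 0.
Proof. by rewrite /ip mxE; apply: eq_bigr=> k _; rewrite mxE. Qed.

Lemma ipJ n (x y : 'cV[C]_n) : conjc (ip x y) = ip y x.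
Proof.
rewrite !ipE rmorph_sum; apply: eq_bigr=> k _.
by rewrite rmorphM /= conjcK mulrC.
Qed.

Lemma ipDl n (x1 x2 y : 'cV[C]_n) : ip (x1 + x2) y = ip x1 y + ip x2 y.
Proof. by rewrite /ip adjD mulmxDl mxE. Qed.
Lemma ipDr n (x y1 y2 : 'cV[C]_n) : ip x (y1 + y2) = ip x y1 + ip x y2.
Proof. by rewrite /ip mulmxDr mxE. Qed.
Lemma ipZl n a (x y : 'cV[C]_n) : ip (a *: x) y = conjc a * ip x y.
Proof. by rewrite /ip adj_scale -scalemxAl mxE. Qed.
Lemma ipZr n a (x y : 'cV[C]_n) : ip x (a *: y) = a * ip x y.
Proof. by rewrite /ip -scalemxAr mxE. Qed.
Lemma ipNl n (x y : 'cV[C]_n) : ip (- x) y = - ip x y.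
Proof. by rewrite -scaleN1r ipZl rmorphN1 mulN1r. Qed.
Lemma ipNr n (x y : 'cV[C]_n) : ip x (- y) = - ip x y.
Proof. by rewrite -scaleN1r ipZr mulN1r. Qed.
Lemma ip0l n (y : 'cV[C]_n) : ip 0 y = 0.
Proof. by rewrite /ip adj0 mul0mx mxE. Qed.
Lemma ip0r n (y : 'cV[C]_n) : ip y 0 = 0.
Proof. by rewrite /ip mulmx0 mxE. Qed.
Lemma ip_adj m n (A : 'M[C]_(m, n)) x y : ip (A *m x) y = ip x (adj A *m y).
Proof. by rewrite /ip adjM mulmxA. Qed.

Lemma cReM (a b : C) : Re (a * b) = Re a * Re b - Im a * Im b.
Proof. by case: a b => [? ?] [? ?]. Qed.
Lemma cImM (a b : C) : Im (a * b) = Re a * Im b + Im a * Re b.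
Proof. by case: a b => [? ?] [? ?]. Qed.
Lemma cReD (a b : C) : Re (a + b) = Re a + Re b.
Proof. by case: a b => [? ?] [? ?]. Qed.
Lemma cImD (a b : C) : Im (a + b) = Im a + Im b.
Proof. by case: a b => [? ?] [? ?]. Qed.
Lemma cReN (a : C) : Re (- a) = - Re a.
Proof. by case: a. Qed.
Lemma cImN (a : C) : Im (- a) = - Im a.
Proof. by case: a. Qed.
Lemma cReJ (a : C) : Re (conjc a) = Re a.
Proof. by case: a. Qed.
Lemma cImJ (a : C) : Im (conjc a) = - Im a.
Proof. by case: a. Qed.
Definition cReImE := (cReM, cImM, cReD, cImD, cReN, cImN, cReJ, cImJ).

Lemma Re_sum (I : Type) (r : seq I) (F : I -> C) :
  Re (\sum_(i <- r) F i) = \sum_(i <- r) Re (F i).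
Proof. by elim/big_rec2: _ => // i y1 y2 _ <-; rewrite cReD. Qed.

Lemma complexP (a b : C) : Re a = Re b -> Im a = Im b -> a = b.
Proof. by case: a b => [? ?] [? ?] /= -> ->. Qed.

Lemma nsqE (z : C) : (nsq z)%:C = z * conjc z.
Proof. by apply: complexP; rewrite !cReImE /nsq /=; ring. Qed.
Lemma nsqM a b : nsq (a * b) = nsq a * nsq b.
Proof. by rewrite /nsq !cReImE; ring. Qed.
Lemma nsqJ a : nsq (conjc a) = nsq a.
Proof. by rewrite /nsq !cReImE; ring. Qed.
Lemma nsqN a : nsq (- a) = nsq a.
Proof. by rewrite /nsq !cReImE; ring. Qed.
Lemma nsq_ge0 a : 0 <= nsq a.
Proof. by rewrite addr_ge0 ?sqr_ge0. Qed.
Lemma nsq_eq0 a : nsq a = 0 -> a = 0.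
Proof.
move=> h; apply/eqP; move/eqP: h; rewrite paddr_eq0 ?sqr_ge0 // !sqrf_eq0.
by case/andP=> /eqP h1 /eqP h2; apply/eqP; apply: complexP.
Qed.
Lemma nsq0 : nsq 0 = 0.
Proof. by rewrite /nsq /= expr0n addr0. Qed.

Lemma ip_nrm n (x : 'cV[C]_n) : ip x x = (nrm x)%:C.
Proof.
apply: complexP => //=; have := congr1 Im (ipJ x x).
rewrite cImJ; lra.
Qed.

Lemma nrmE n (x : 'cV[C]_n) : nrm x = \sum_k nsq (x k 0).
Proof.
apply: complexI; rewrite -ip_nrm ipE rmorph_sum; apply: eq_bigr=> k _.
by rewrite mulrC -nsqE.
Qed.
Lemma nrm_ge0 n (x : 'cV[C]_n) : 0 <= nrm x.
Proof. by rewrite nrmE sumr_ge0 // => k _; exact: nsq_ge0. Qed.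
Lemma nrm_eq0 n (x : 'cV[C]_n) : nrm x = 0 -> x = 0.
Proof.
rewrite nrmE => /eqP; rewrite psumr_eq0; last by move=> k _; exact: nsq_ge0.
move=> /allP h; apply/matrixP=> k j; rewrite ord1 mxE; apply: nsq_eq0; apply/eqP.
by apply: (h k); rewrite mem_index_enum.
Qed.
Lemma nrm0 n : nrm (0 : 'cV[C]_n) = 0.
Proof. by rewrite /nrm ip0l. Qed.
Lemma nrmZ n a (x : 'cV[C]_n) : nrm (a *: x) = nsq a * nrm x.
Proof. by rewrite !nrmE mulr_sumr; apply: eq_bigr=> k _; rewrite mxE nsqM. Qed.
Lemma nrm_gt0 n (x : 'cV[C]_n) : x != 0 -> 0 < nrm x.
Proof.
move=> h; rewrite lt_neqAle nrm_ge0 andbT eq_sym; apply/eqP=> /nrm_eq0 h'.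
by rewrite h' eqxx in h.
Qed.

Lemma sformDl m n (X : 'M[C]_(m, n)) x1 x2 y :
  sform X (x1 + x2) y = sform X x1 y + sform X x2 y.
Proof. exact: ipDl. Qed.
Lemma sformDr m n (X : 'M[C]_(m, n)) x y1 y2 :
  sform X x (y1 + y2) = sform X x y1 + sform X x y2.
Proof. by rewrite /sform mulmxDr ipDr. Qed.
Lemma sformZl m n (X : 'M[C]_(m, n)) a x y :
  sform X (a *: x) y = conjc a * sform X x y.
Proof. exact: ipZl. Qed.
Lemma sformZr m n (X : 'M[C]_(m, n)) a x y : sform X x (a *: y) = a * sform X x y.
Proof. by rewrite /sform -scalemxAr ipZr. Qed.
Lemma sform0l m n (X : 'M[C]_(m, n)) y : sform X 0 y = 0.
Proof. exact: ip0l. Qed.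
Lemma sform0r m n (X : 'M[C]_(m, n)) y : sform X y 0 = 0.
Proof. by rewrite /sform mulmx0 ip0r. Qed.
Lemma sformJ m n (X : 'M[C]_(m, n)) x y : conjc (sform X x y) = sform (adj X) y x.
Proof. by rewrite /sform ipJ ip_adj. Qed.
Lemma sform1 n (x y : 'cV[C]_n) : sform 1%:M x y = ip x y.
Proof. by rewrite /sform mul1mx. Qed.
Lemma qfZ n (X : 'M[C]_n) a x : qf X (a *: x) = nsq a * qf X x.
Proof.
rewrite /qf sformZl sformZr mulrA -[conjc _ * a]mulrC -nsqE cReM /=.
by rewrite mul0r subr0.
Qed.
Lemma sform_mul m n p q (X : 'M[C]_(m, n)) (E : 'M[C]_(m, p)) (F : 'M[C]_(n, q)) x y :
  sform (adj E *m X *m F) x y = sform X (E *m x) (F *m y).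
Proof. by rewrite /sform ip_adj !mulmxA. Qed.

Lemma psdP n (X : 'M[C]_n) : psd X <-> adj X = X /\ forall x, 0 <= qf X x.
Proof.
have E x : (adj x *m X *m x) 0 0 = sform X x x by rewrite /sform /ip mulmxA.
split=> -[hX h]; split=> // x; have := h x; rewrite E.
  by rewrite lecE => /andP[].
by move=> h1; rewrite lecE -/(qf X x) h1 andbT; have := congr1 Im (sformJ X x x);
  rewrite hX cImJ => h2; apply/eqP; rewrite /=; lra.
Qed.

Lemma herm_qf n (X : 'M[C]_n) x : adj X = X -> sform X x x = (qf X x)%:C.
Proof.
move=> hX; apply: complexP => //=; have := congr1 Im (sformJ X x x).
by rewrite hX cImJ => h2; lra.
Qed.

Lemma psd_conj n p (X : 'M[C]_n) (E : 'M[C]_(n, p)) : psd X -> psd (adj E *m X *m E).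
Proof.
move=> /psdP[hX h]; apply/psdP; split=> [|x].
  by rewrite !adjM adjK hX mulmxA.
by rewrite /qf sform_mul; exact: h.
Qed.

(** * Spectral decompositions and mixtures *)

Lemma mulmx_diag_sum n (V : 'M[C]_n) (d : 'rV[C]_n) :
  V *m diag_mx d *m adj V = \sum_k d 0 k *: proj (col k V).
Proof.
apply/matrixP=> i j; rewrite mul_mx_diag !mxE summxE; apply: eq_bigr=> k _.
by rewrite !mxE big_ord1 !mxE mulrA [d 0 k * _]mulrC.
Qed.

Lemma normal_spectral n (A : 'M[C]_n) : A *m adj A = adj A *m A ->
  exists V : 'M[C]_n, exists d : 'I_n -> C,
    adj V *m V = 1%:M /\ A = \sum_k d k *: proj (col k V).
Proof.
rewrite !adjE => /normalmxP /orthomx_spectralP hA.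
have /unitarymxP hP := spectral_unitarymx A.
exists (adj (spectralmx A)), (fun k => spectral_diag A 0 k); rewrite adjK adjE hP.
split=> //; rewrite -adjE -mulmx_diag_sum adjK.
by rewrite adjE -invmx_unitary ?spectral_unitarymx.
Qed.

Lemma ip_col n p (V : 'M[C]_(p, n)) i j : adj V *m V = 1%:M ->
  ip (col i V) (col j V) = (i == j)%:R.
Proof.
move=> /matrixP/(_ i j); rewrite [in RHS]mxE => <-; rewrite ipE mxE.
by apply: eq_bigr=> k _; rewrite !mxE.
Qed.

Lemma nrm_col n p (V : 'M[C]_(p, n)) i : adj V *m V = 1%:M -> nrm (col i V) = 1.
Proof. by move=> hV; rewrite /nrm ip_col // eqxx. Qed.

Lemma sum_proj_col n (V : 'M[C]_n) : adj V *m V = 1%:M ->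
  \sum_k proj (col k V) = 1%:M.
Proof.
move=> /mulmx1C hV.
have := mulmx_diag_sum V (const_mx 1); rewrite diag_const_mx mulmx1 hV => ->.
by apply: eq_bigr=> k _; rewrite mxE scale1r.
Qed.

Lemma proj_mul n (u x : 'cV[C]_n) : proj u *m x = ip u x *: u.
Proof.
rewrite /proj -mulmxA; apply/matrixP=> i j; rewrite !mxE big_ord1 mulrC.
by rewrite !ord1.
Qed.

Lemma adj_proj n (u : 'cV[C]_n) : adj (proj u) = proj u.
Proof. by rewrite adjM adjK. Qed.

Lemma projZ n a (u : 'cV[C]_n) : proj (a *: u) = (nsq a)%:C *: proj u.
Proof. by rewrite /proj adj_scale -scalemxAl -scalemxAr scalerA nsqE. Qed.

Lemma proj_conj m n (E : 'M[C]_(m, n)) u : proj (E *m u) = E *m proj u *m adj E.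
Proof. by rewrite /proj adjM !mulmxA. Qed.

Lemma sform_proj n (u x y : 'cV[C]_n) : sform (proj u) x y = ip x u * ip u y.
Proof. by rewrite /sform proj_mul ipZr mulrC. Qed.

Lemma qf_proj n (u x : 'cV[C]_n) : qf (proj u) x = nsq (ip u x).
Proof. by rewrite /qf sform_proj -ipJ mulrC -nsqE. Qed.

Lemma sform_sum m n (I : Type) (r : seq I) (F : I -> 'M[C]_(m, n)) x y :
  sform (\sum_(i <- r) F i) x y = \sum_(i <- r) sform (F i) x y.
Proof. by rewrite /sform /ip mulmx_suml mulmx_sumr summxE. Qed.

Lemma sformXZ m n a (X : 'M[C]_(m, n)) x y : sform (a *: X) x y = a * sform X x y.
Proof. by rewrite /sform -scalemxAl ipZr. Qed.

Lemma sformXD m n (X Y : 'M[C]_(m, n)) x y :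
  sform (X + Y) x y = sform X x y + sform Y x y.
Proof. by rewrite /sform mulmxDl ipDr. Qed.

Lemma sformXN m n (X : 'M[C]_(m, n)) x y : sform (- X) x y = - sform X x y.
Proof. by rewrite /sform mulNmx ipNr. Qed.

Lemma sform_spectral n (V : 'M[C]_n) (d : 'I_n -> C) j :
  adj V *m V = 1%:M ->
  sform (\sum_k d k *: proj (col k V)) (col j V) (col j V) = d j.
Proof.
move=> hV; rewrite sform_sum (bigD1 j) //= big1 ?addr0 => [|i ne].
  by rewrite sformXZ sform_proj !ip_col // eqxx !mulr1.
by rewrite sformXZ sform_proj !ip_col // (negPf ne) !mulr0.
Qed.

Lemma herm_spectral n (A : 'M[C]_n) : adj A = A ->
  exists V : 'M[C]_n, exists d : 'I_n -> R,
    adj V *m V = 1%:M /\ A = \sum_k (d k)%:C *: proj (col k V).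
Proof.
move=> hA; have [|V [d [hV hd]]] := @normal_spectral _ A; first by rewrite hA.
exists V, (fun k => qf A (col k V)); split=> //; rewrite {1}hd.
by apply: eq_bigr=> k _; rewrite -herm_qf // hd sform_spectral.
Qed.

(** Weights are absorbed into unnormalised kets, which makes mixtures stable under sums and
    congruences; [SN_le_of_mixof] restores the normalisation. *)
Definition mixof n (P : 'cV[C]_n -> Prop) (X : 'M[C]_n) : Prop :=
  exists s : seq 'cV[C]_n, X = \sum_(u <- s) proj u /\ {in s, forall u, P u}.

Lemma mixofD n (P : 'cV[C]_n -> Prop) X Y :
  mixof P X -> mixof P Y -> mixof P (X + Y).
Proof.
move=> [s [-> hs]] [r [-> hr]]; exists (s ++ r); rewrite big_cat; split=> // u.
by rewrite mem_cat => /orP[/hs|/hr].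
Qed.

Lemma mixof_sum n (P : 'cV[C]_n -> Prop) (I : Type) (r : seq I) (F : I -> 'M[C]_n) :
  (forall i, mixof P (F i)) -> mixof P (\sum_(i <- r) F i).
Proof.
move=> h; elim: r => [|i r ih]; first by exists [::]; rewrite !big_nil.
by rewrite big_cons; exact: mixofD.
Qed.

Lemma mixof1 n (P : 'cV[C]_n -> Prop) u : P u -> mixof P (proj u).
Proof. by exists [:: u]; rewrite big_seq1; split=> // v; rewrite inE => /eqP->. Qed.

Lemma mixof_conj m n (P : 'cV[C]_n -> Prop) (Q : 'cV[C]_m -> Prop)
  (E : 'M[C]_(m, n)) X : (forall u, P u -> Q (E *m u)) ->
  mixof P X -> mixof Q (E *m X *m adj E).
Proof.
move=> h [s [-> hs]]; exists [seq E *m u | u <- s]; split.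
  rewrite big_map mulmx_sumr mulmx_suml; apply: eq_bigr=> u _.
  by rewrite proj_conj.
by move=> _ /mapP[u us ->]; exact/h/hs.
Qed.

Lemma mixofZ n (P : 'cV[C]_n -> Prop) (a : R) X :
  (forall c u, P u -> P (c *: u)) -> 0 <= a -> mixof P X -> mixof P (a%:C *: X).
Proof.
move=> hP a0 [s [-> hs]]; exists [seq (Num.sqrt a)%:C *: u | u <- s]; split.
  rewrite big_map scaler_sumr; apply: eq_bigr=> u _.
  by rewrite projZ /nsq /= expr0n addr0 sqr_sqrtr.
by move=> _ /mapP[u us ->]; exact/hP/hs.
Qed.

Lemma psd_mixof n (X : 'M[C]_n) : psd X -> mixof (fun=> True) X.
Proof.
move=> /psdP[hX h]; have [V [d [hV hd]]] := herm_spectral hX; rewrite hd.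
apply: mixof_sum => k; apply: mixofZ => //; last exact: mixof1.
have := h (col k V); rewrite /qf hd sform_spectral //.
Qed.

(** Take an eigenvector of the least eigenvalue: in the eigenbasis the shifted matrix has the
    coefficients [d k - d k0]. *)
Lemma min_eigen n (X : 'M[C]_n.+1) : adj X = X ->
  exists x, nrm x = 1 /\ psd (X - (qf X x)%:C%:M).
Proof.
move=> hX; have [V [d [hV hd]]] := herm_spectral hX.
have [k0 _ hk] := @arg_minP _ _ _ ord0 xpredT d isT.
exists (col k0 V); split; first exact: nrm_col.
have -> : qf X (col k0 V) = d k0 by rewrite /qf hd sform_spectral.
apply/psdP; split=> [|x].
  by rewrite adjB hX adj_scalar conjc_real.
rewrite -[_%:M]mulmx1 mul_scalar_mx -(sum_proj_col hV) hd scaler_sumr -sumrB.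
rewrite /qf sform_sum Re_sum sumr_ge0 // => k _.
rewrite -scalerBl -rmorphB sformXZ cReM /= mul0r subr0.
by rewrite mulr_ge0 ?subr_ge0 ?hk // -/(qf _ _) qf_proj nsq_ge0.
Qed.

(** * Separability of 2 x m blocks *)

Lemma sum_block_mx m n p q (I : Type) (r : seq I) (A : I -> 'M[C]_(m, p))
    (B : I -> 'M[C]_(m, q)) (A' : I -> 'M[C]_(n, p)) (B' : I -> 'M[C]_(n, q)) :
  \sum_(i <- r) block_mx (A i) (B i) (A' i) (B' i) =
  block_mx (\sum_(i <- r) A i) (\sum_(i <- r) B i)
           (\sum_(i <- r) A' i) (\sum_(i <- r) B' i).
Proof.
elim: r => [|i r ih]; first by rewrite !big_nil block_mx0.
by rewrite !big_cons ih add_block_mx.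
Qed.

Lemma adj_block_mx m n p q (A : 'M[C]_(m, p)) (B : 'M[C]_(m, q))
    (A' : 'M[C]_(n, p)) (B' : 'M[C]_(n, q)) :
  adj (block_mx A B A' B') = block_mx (adj A) (adj A') (adj B) (adj B').
Proof. by rewrite {1}/block_mx adj_col_mx !adj_row_mx block_mxEh. Qed.

Lemma proj_col_mx m n (a : 'cV[C]_m) (b : 'cV[C]_n) :
  proj (col_mx a b) =
  block_mx (proj a) (a *m adj b) (b *m adj a) (proj b).
Proof. by rewrite /proj adj_col_mx mul_col_row. Qed.

Lemma unitaryC n (U : 'M[C]_n) : unitary U -> adj U *m U = 1%:M.
Proof. exact: mulmx1C. Qed.

Lemma nrm_unitary n (U : 'M[C]_n) x : unitary U -> nrm (U *m x) = nrm x.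
Proof. by move=> /unitaryC hU; rewrite /nrm ip_adj mulmxA hU mul1mx. Qed.

Lemma mulmx_spectral_col n (V : 'M[C]_n) (d : 'I_n -> C) j :
  adj V *m V = 1%:M ->
  (\sum_k d k *: proj (col k V)) *m col j V = d j *: col j V.
Proof.
move=> hV; rewrite mulmx_suml (bigD1 j) //= big1 ?addr0 => [|i ne].
  by rewrite -scalemxAl proj_mul ip_col // eqxx scale1r.
by rewrite -scalemxAl proj_mul ip_col // (negPf ne) scale0r scaler0.
Qed.

(** The product of [(g0, g1)] in C^2 with [z] in C^m, written as two stacked blocks. *)
Definition prodket m (u : 'cV[C]_(m + m)) : Prop :=
  exists g0 g1 (z : 'cV[C]_m), u = col_mx (g0 *: z) (g1 *: z).

Lemma prodketZ m c (u : 'cV[C]_(m + m)) : prodket u -> prodket (c *: u).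
Proof.
move=> [g0 [g1 [z ->]]]; exists (c * g0), (c * g1), z.
by rewrite scale_col_mx !scalerA.
Qed.

(** The eigenvalues [d k] of [N] have modulus one, and the block matrix is the sum of the dyads of
    the product kets of [(1, conjc (d k))] with the eigenvectors. *)
Lemma unitary_block_separable m (N : 'M[C]_m) : unitary N ->
  mixof (@prodket m) (block_mx 1%:M N (adj N) 1%:M).
Proof.
move=> hN; have [|V [d [hV hd]]] := @normal_spectral _ N.
  by rewrite hN unitaryC.
have hd1 k : nsq (d k) = 1.
  rewrite -[RHS](nrm_col k hV) -(nrm_unitary _ hN) hd mulmx_spectral_col //.
  by rewrite nrmZ nrm_col // mulr1.
have -> : block_mx 1%:M N (adj N) 1%:M =
  \sum_k proj (col_mx (1 *: col k V) (conjc (d k) *: col k V)).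
  under eq_bigr do rewrite proj_col_mx !projZ nsqJ hd1 /nsq expr1n expr0n addr0.
  under eq_bigr do rewrite !scale1r adj_scale conjcK -scalemxAr -scalemxAl.
  rewrite sum_block_mx sum_proj_col // {2}hd adj_sum -hd; congr block_mx.
  by apply: eq_bigr => k _; rewrite adj_scale adj_proj.
by apply: mixof_sum => k; apply: mixof1; exists 1, (conjc (d k)), (col k V).
Qed.

(* The self-adjoint dilation [H] of [K] is the average of the unitaries
   [H +- i sqrt (1 - H^2)], and [K] is a corner of [H] times the flip. *)
Lemma contraction_dilation m (K : 'M[C]_m) :
  (forall v w, nsq (sform K v w) <= nrm v * nrm w) ->
  exists N1 N2 : 'M[C]_(m + m), [/\ unitary N1, unitary N2 &
    row_mx 1%:M 0 *m (N1 + N2) *m adj (row_mx 1%:M 0) = 2%:R *: K].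
Proof.
move=> hK; pose H := block_mx 0 K (adj K) 0.
have hH : adj H = H by rewrite adj_block_mx !adj0 adjK.
have [V [d [hV hd]]] := herm_spectral hH.
(* For a unit eigenvector with halves [p] and [q], the eigenvalue is [2 * Re (sform K p q)], whose
   square is at most [4 * nrm p * nrm q <= (nrm p + nrm q) ^+ 2 = 1]. *)
have d1 k : d k ^+ 2 <= 1.
  have : sform H (col k V) (col k V) = (d k)%:C by rewrite hd sform_spectral.
  have := nrm_col k hV; rewrite -[col k V]vsubmxK.
  set p := usubmx _; set q := dsubmx _.
  have -> : nrm (col_mx p q) = nrm p + nrm q.
    by rewrite /nrm /ip adj_col_mx mul_row_col mxE cReD.
  have -> : sform H (col_mx p q) (col_mx p q) = sform K p q + conjc (sform K p q).
    rewrite sformJ /sform /ip mul_block_col !mul0mx addr0 add0r.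
    by rewrite adj_col_mx mul_row_col mxE.
  move=> hpq /(congr1 Re); rewrite cReD cReJ /= => <-.
  have := hK p q; have := nrm_ge0 p; have := nrm_ge0 q.
  have := sqr_ge0 (nrm p - nrm q); have := sqr_ge0 (Im (sform K p q)).
  rewrite /nsq; nra.
pose e k : C := d k +i* Num.sqrt (1 - d k ^+ 2).
have e1 k : e k * conjc (e k) = 1.
  by rewrite -nsqE /nsq /= sqr_sqrtr ?subr_ge0 // addrC subrK.
pose U := \sum_k e k *: proj (col k V).
have adjU : adj U = \sum_k conjc (e k) *: proj (col k V).
  by rewrite adj_sum; apply: eq_bigr => k _; rewrite adj_scale adj_proj.
have hU : unitary U.
  rewrite /unitary {1}/U mulmx_suml -(sum_proj_col hV); apply: eq_bigr => k _.
  rewrite -scalemxAl /proj -mulmxA -adjM mulmx_spectral_col // adj_scale.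
  by rewrite -scalemxAr scalerA e1 scale1r.
pose X : 'M[C]_(m + m) := block_mx 0 1%:M 1%:M 0.
have hX : unitary X.
  rewrite /unitary adj_block_mx !adj0 !adj1 mulmx_block !mulmx0 !mul0mx !mul1mx.
  by rewrite !addr0 !add0r -scalar_mx_block.
have uX W : unitary W -> unitary (W *m X).
  by move=> hW; rewrite /unitary adjM !mulmxA -(mulmxA W) hX mulmx1.
exists (U *m X), (adj U *m X); split; [exact: uX| |].
  by apply: uX; rewrite /unitary adjK unitaryC.
have -> : U *m X + adj U *m X = 2%:R *: (H *m X).
  rewrite -mulmxDl adjU -big_split /= scalemxAl hd scaler_sumr; congr (_ *m _).
  apply: eq_bigr => k _; rewrite -scalerDl scalerA; congr (_ *: _).
  by apply: complexP; rewrite !cReImE /=; ring.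
rewrite -scalemxAr -scalemxAl mulmx_block !mulmx0 !mul0mx !mulmx1 !addr0 !add0r.
rewrite adj_row_mx adj0 adj1 mul_row_block !mul1mx !mul0mx !addr0.
by rewrite mul_row_col mulmx1 mulmx0 addr0.
Qed.

(** The block matrix is half the sum of the two unitary blocks of the dilation, compressed by [S] on
    the second factor; such a compression keeps product kets product. *)
Lemma contraction_separable m (K : 'M[C]_m) :
  (forall v w, nsq (sform K v w) <= nrm v * nrm w) ->
  mixof (@prodket m) (block_mx 1%:M K (adj K) 1%:M).
Proof.
move=> /contraction_dilation[N1 [N2 [h1 h2]]]; set S := row_mx _ _ => hN.
pose E := block_mx S 0 0 S.
have SS : S *m adj S = 1%:M.
  by rewrite adj_row_mx mul_row_col adj1 adj0 mulmx0 addr0 mulmx1.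
have -> : block_mx 1%:M K (adj K) 1%:M = (2%:R^-1 : R)%:C *:
    (E *m (block_mx 1%:M N1 (adj N1) 1%:M + block_mx 1%:M N2 (adj N2) 1%:M)
       *m adj E).
  rewrite add_block_mx -adjD adj_block_mx !adj0 !mulmx_block.
  rewrite !(mul0mx, mulmx0, addr0, add0r) hN.
  have -> : S *m adj (N1 + N2) *m adj S = 2%:R *: adj K.
    by rewrite -mulmxA -adjM -[S]adjK -adjM adjK hN adj_scale rmorph_nat.
  have -> : S *m (1%:M + 1%:M) *m adj S = 2%:R *: 1%:M.
    by rewrite mulmxDr mulmx1 mulmxDl SS scaler_nat.
  have e : (2%:R^-1 : R)%:C * 2%:R = 1.
    by apply: complexP; rewrite !cReImE /=; field.
  by rewrite scale_block_mx !scalerA e !scale1r.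
apply: mixofZ; first by move=> c u; exact: prodketZ.
  by rewrite invr_ge0.
apply: (mixof_conj (P := @prodket (m + m))).
  move=> _ [g0 [g1 [z ->]]]; exists g0, g1, (S *m z).
  by rewrite mul_block_col !mul0mx addr0 add0r -!scalemxAr.
by apply: mixofD; exact: unitary_block_separable.
Qed.

Lemma sform_delta m n (X : 'M[C]_(m, n)) i j :
  sform X (delta_mx i 0) (delta_mx j 0) = X i j.
Proof.
rewrite /sform ipE (bigD1 i) //= big1 ?addr0 => [|k /negPf ne].
  rewrite [delta_mx _ _ _ _]mxE !eqxx rmorph1 mul1r mxE (bigD1 j) //=.
  rewrite big1 ?addr0 => [|k /negPf ne].
    by rewrite mxE !eqxx mulr1.
  by rewrite mxE ne mulr0.
by rewrite [delta_mx _ _ _ _]mxE ne rmorph0 mul0r.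
Qed.

(** Subtracting the least eigenvalues [a] of [A] and [c] of [D] leaves positive remainders, which
    contribute product kets with one zero block. The rest is the block matrix of the contraction
    [K = B / sqrt (a * c)], with its two blocks scaled by [sqrt a] and [sqrt c]. *)
Lemma block_separable m (A B D : 'M[C]_m.+1) : psd A -> psd D ->
  (forall x y v w, nsq (sform B v w) * (nrm x * nrm y) <=
                   qf A x * qf D y * (nrm v * nrm w)) ->
  mixof (@prodket m.+1) (block_mx A B (adj B) D).
Proof.
move=> /psdP[hA pA] /psdP[hD pD] h.
have [x [nx hx]] := min_eigen hA; have [y [ny hy]] := min_eigen hD.
have {}h v w : nsq (sform B v w) <= qf A x * qf D y * (nrm v * nrm w).
  by have := h x y v w; rewrite nx ny !mulr1.
set a := qf A x in hx h; set c := qf D y in hy h.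
have a0 : 0 <= a := pA x; have c0 : 0 <= c := pD y.
clearbody a c.
have [K [hK BK]] : exists K : 'M[C]_m.+1,
    (forall v w, nsq (sform K v w) <= nrm v * nrm w) /\
    B = (Num.sqrt a * Num.sqrt c)%:C *: K.
  (* If [a * c = 0], the bound forces [B = 0], and [K = 0] serves. *)
  have [ac|ac] := eqVneq (a * c) 0.
    exists 0; split=> [v w|].
      by rewrite /sform mul0mx ip0r nsq0 mulr_ge0 ?nrm_ge0.
    rewrite scaler0; apply/matrixP=> i j; rewrite mxE -sform_delta.
    apply: nsq_eq0; apply/eqP; rewrite eq_le nsq_ge0 andbT.
    by have := h (delta_mx i 0) (delta_mx j 0); rewrite ac mul0r.
  have ac0 : 0 < a * c by rewrite lt_neqAle eq_sym ac mulr_ge0.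
  set s := Num.sqrt a * Num.sqrt c.
  have s2 : s ^+ 2 = a * c by rewrite exprMn !sqr_sqrtr.
  have s0 : s != 0 by apply: contraNneq ac => s0; rewrite -s2 s0 expr0n.
  exists ((s^-1)%:C *: B); split=> [v w|].
    rewrite sformXZ nsqM /nsq /= expr0n addr0 exprVn s2 -/(nsq _).
    by rewrite mulrC ler_pdivrMr // mulrC; exact: h.
  by rewrite scalerA -rmorphM divff // scale1r.
move: (sqr_sqrtr a0) (sqr_sqrtr c0) BK.
move: (Num.sqrt a) (Num.sqrt c) => sa sc sa2 sc2 BK.
have -> : block_mx A B (adj B) D =
   (block_mx (A - a%:C%:M) 0 0 0 + block_mx 0 0 0 (D - c%:C%:M)) +
   block_mx a%:C%:M B (adj B) c%:C%:M.
  by rewrite !add_block_mx !(addr0, add0r) !subrK.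
apply: mixofD; first apply: mixofD.
- have -> : block_mx (A - a%:C%:M) 0 0 0 =
     col_mx 1%:M 0 *m (A - a%:C%:M) *m adj (col_mx 1%:M 0) :> 'M[C]_(m.+1 + m.+1).
    rewrite adj_col_mx adj0 adj1 mul_col_mx mul1mx mul0mx mul_col_row.
    by rewrite !mulmx0 mulmx1 mul0mx.
  apply: mixof_conj (psd_mixof hx) => u _; exists 1, 0, u.
  by rewrite mul_col_mx mul1mx mul0mx scale1r scale0r.
- have -> : block_mx 0 0 0 (D - c%:C%:M) =
     col_mx 0 1%:M *m (D - c%:C%:M) *m adj (col_mx 0 1%:M) :> 'M[C]_(m.+1 + m.+1).
    rewrite adj_col_mx adj0 adj1 mul_col_mx mul1mx mul0mx mul_col_row.
    by rewrite !(mulmx0, mulmx1, mul0mx).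
  apply: mixof_conj (psd_mixof hy) => u _; exists 0, 1, u.
  by rewrite mul_col_mx mul1mx mul0mx scale1r scale0r.
pose E : 'M[C]_(m.+1 + m.+1) := block_mx sa%:C%:M 0 0 sc%:C%:M.
have -> : block_mx a%:C%:M B (adj B) c%:C%:M =
          E *m block_mx 1%:M K (adj K) 1%:M *m adj E.
  rewrite [adj E]adj_block_mx !adj0 !adj_scalar !conjc_real !mulmx_block.
  rewrite !(mul0mx, mulmx0, addr0, add0r) !mulmx1 !mul_scalar_mx !mul_mx_scalar.
  rewrite !scalerA !scale_scalar_mx -!rmorphM -!expr2 sa2 sc2 BK adj_scale conjc_real.
  by rewrite [sc * _]mulrC.
apply: mixof_conj (contraction_separable hK) => _ [g0 [g1 [z ->]]].
exists (sa%:C * g0), (sc%:C * g1), z.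
by rewrite mul_block_col !mul0mx addr0 add0r !mul_scalar_mx !scalerA.
Qed.

(** * Continuity and cones of Hermitian forms *)

(** Continuity is used only along curves with a real parameter, so it is stated for the real and
    imaginary parts of each entry. *)
Definition ccont (g : R -> C) : Prop :=
  continuous (fun t => Re (g t)) /\ continuous (fun t => Im (g t)).
Definition mcont m n (M : R -> 'M[C]_(m, n)) : Prop :=
  forall i j, ccont (fun t => M t i j).

Lemma ccont_real (g : R -> R) : continuous g -> ccont (fun t => (g t)%:C).
Proof. by move=> h; split=> //= t; exact: cvg_cst. Qed.

Lemma ccont_cst c : ccont (fun=> c).
Proof. by split=> t; exact: cvg_cst. Qed.

Lemma fun_contD (f g : R -> R) :
  continuous f -> continuous g -> continuous (fun t => f t + g t).
Proof. by move=> cf cg t; exact: (continuousD (cf t) (cg t)). Qed.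

Lemma fun_contN (f : R -> R) : continuous f -> continuous (fun t => - f t).
Proof. by move=> cf t; exact: (continuousN (cf t)). Qed.

Lemma fun_contM (f g : R -> R) :
  continuous f -> continuous g -> continuous (fun t => f t * g t).
Proof. by move=> cf cg t; exact: (continuousM (cf t) (cg t)). Qed.

Lemma ccontD g h : ccont g -> ccont h -> ccont (fun t => g t + h t).
Proof.
move=> [g1 g2] [h1 h2]; split; under eq_fun do rewrite ?cReD ?cImD;
  exact: fun_contD.
Qed.

Lemma ccontM g h : ccont g -> ccont h -> ccont (fun t => g t * h t).
Proof.
move=> [g1 g2] [h1 h2]; split; under eq_fun do rewrite ?cReM ?cImM.
  by apply: fun_contD; last apply: fun_contN; exact: fun_contM.
by apply: fun_contD; exact: fun_contM.
Qed.

Lemma ccont_conj g : ccont g -> ccont (fun t => conjc (g t)).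
Proof.
move=> [g1 g2]; split; under eq_fun do rewrite ?cReJ ?cImJ; first exact: g1.
exact: fun_contN.
Qed.

Lemma ccont_sum (I : Type) (r : seq I) (g : I -> R -> C) :
  (forall i, ccont (g i)) -> ccont (fun t => \sum_(i <- r) g i t).
Proof.
move=> h; elim: r => [|i r ih].
  by under eq_fun do rewrite big_nil; exact: ccont_cst.
by under eq_fun do rewrite big_cons; exact: ccontD.
Qed.

Lemma ccont_nsq g : ccont g -> continuous (fun t => nsq (g t)).
Proof.
move=> [g1 g2]; rewrite /nsq; under eq_fun do rewrite !expr2.
by apply: fun_contD; exact: fun_contM.
Qed.

Lemma mcont_cst m n (M : 'M[C]_(m, n)) : mcont (fun=> M).
Proof. by move=> i j; exact: ccont_cst. Qed.

Lemma mcontD m n (M N : R -> 'M[C]_(m, n)) :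
  mcont M -> mcont N -> mcont (fun t => M t + N t).
Proof. by move=> hM hN i j; under eq_fun do rewrite mxE; exact: ccontD. Qed.

Lemma mcontZ m n (a : R -> R) (M : R -> 'M[C]_(m, n)) :
  continuous a -> mcont M -> mcont (fun t => (a t)%:C *: M t).
Proof.
move=> ha hM i j; under eq_fun do rewrite mxE.
by apply: ccontM => //; exact: ccont_real.
Qed.

Lemma mcont_adj m n (M : R -> 'M[C]_(m, n)) : mcont M -> mcont (fun t => adj (M t)).
Proof. by move=> hM i j; under eq_fun do rewrite mxE; exact: ccont_conj. Qed.

Lemma mcontM m n p (M : R -> 'M[C]_(m, n)) (N : R -> 'M[C]_(n, p)) :
  mcont M -> mcont N -> mcont (fun t => M t *m N t).
Proof.
move=> hM hN i j; under eq_fun do rewrite mxE.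
by apply: ccont_sum => k; exact: ccontM.
Qed.

Lemma ccont_sform m n (X : R -> 'M[C]_(m, n)) x y :
  mcont X -> mcont x -> mcont y -> ccont (fun t => sform (X t) (x t) (y t)).
Proof.
by move=> hX hx hy; apply: mcontM; [exact: mcont_adj|exact: mcontM].
Qed.

Lemma continuous_qf n (X : R -> 'M[C]_n) x :
  mcont X -> mcont x -> continuous (fun t => qf (X t) (x t)).
Proof. by move=> hX hx; have [] := ccont_sform hX hx hx. Qed.

Lemma ccont_ip n (x y : R -> 'cV[C]_n) :
  mcont x -> mcont y -> ccont (fun t => ip (x t) (y t)).
Proof. by move=> hx hy; apply: mcontM => //; exact: mcont_adj. Qed.

Lemma continuous_nrm n (x : R -> 'cV[C]_n) :
  mcont x -> continuous (fun t => nrm (x t)).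
Proof. by move=> hx; have [] := ccont_ip hx hx. Qed.

Lemma continuous_sign (f : R -> R) a b : a <= b -> continuous f ->
  (forall t, a <= t <= b -> f t != 0) -> (0 < f a) = (0 < f b).
Proof.
move=> ab cf h.
have ha : f a != 0 by apply: h; rewrite lexx.
have hb : f b != 0 by apply: h; rewrite lexx andbT.
have [|e] := eqVneq (0 < f a) (0 < f b); first by [].
have [] := @IVT R f a b 0 ab.
- by apply: continuous_subspaceT.
- rewrite ge_min le_max.
  move: e ha hb; case: (ltgtP 0 (f a)); case: (ltgtP 0 (f b)) => //=;
    by rewrite ?eqxx ?orbT.
move=> t; rewrite in_itv /= => /h /[swap] ->.
by rewrite eqxx.
Qed.

Definition segment n (x1 x2 : 'cV[C]_n) (t : R) : 'cV[C]_n :=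
  (1 - t)%:C *: x1 + t%:C *: x2.

Lemma mcont_segment n (x1 x2 : 'cV[C]_n) : mcont (segment x1 x2).
Proof.
apply: mcontD; apply: mcontZ; try exact: mcont_cst.
  by apply: fun_contD; [|apply: fun_contN] => t; [exact: cvg_cst|exact: cvg_id].
by move=> t; exact: cvg_id.
Qed.

(** The witness is [conjc z] divided by the modulus of [z], or [1] when [z = 0]. It serves to make
    cross terms real with a chosen sign. *)
Lemma align_phase (z : C) :
  exists w : C, nsq w = 1 /\ w * z = (Num.sqrt (nsq z))%:C.
Proof.
have [->|z0] := eqVneq z 0.
  by exists 1; rewrite mulr0 nsq0 sqrtr0 /nsq /= expr1n expr0n addr0.
have nz : 0 < nsq z.
  rewrite lt_neqAle nsq_ge0 andbT eq_sym; apply/eqP => /nsq_eq0 e.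
  by rewrite e eqxx in z0.
have s0 : 0 < Num.sqrt (nsq z) by rewrite sqrtr_gt0.
exists ((Num.sqrt (nsq z))^-1%:C * conjc z); split.
  rewrite nsqM nsqJ {1}/nsq /= expr0n addr0 exprVn sqr_sqrtr ?nsq_ge0 //.
  by rewrite mulVf // gt_eqF.
rewrite -mulrA [conjc z * z]mulrC -nsqE -rmorphM -{2}(sqr_sqrtr (ltW nz)).
by rewrite expr2 mulrA mulVf ?mul1r ?gt_eqF.
Qed.

(* After aligning the phase of [x2] with [x1], a Hermitian form positive at
   both points is positive on the whole segment. *)
Lemma hermitian_cone_sign n (T : 'M[C]_n) (P : 'cV[C]_n -> R) x1 x2 :
  adj T = T ->
  (forall x y, continuous (fun t => P (segment x y t))) ->
  (forall w x, nsq w = 1 -> P (w *: x) = P x) ->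
  (forall x, 0 < qf T x -> P x != 0) ->
  0 < qf T x1 -> 0 < qf T x2 -> (0 < P x1) = (0 < P x2).
Proof.
move=> hT cP PZ hP q1 q2.
have [w [w1 /(congr1 Re) wz]] := align_phase (sform T x1 x2).
have {}wz : 0 <= Re (w * sform T x1 x2) by rewrite wz sqrtr_ge0.
rewrite -(PZ w x2 w1).
have := @continuous_sign (fun t => P (segment x1 (w *: x2) t)) 0 1 ler01 (cP _ _).
rewrite /segment subr0 subrr !scale0r !scale1r addr0 add0r; apply=> t /andP[t0 t1].
apply: hP; rewrite /qf !(sformDl, sformDr, sformZl, sformZr) !conjc_real.
have e21 : sform T x2 x1 = conjc (sform T x1 x2) by rewrite sformJ hT.
rewrite !herm_qf // e21.
move: q1 q2 wz w1 {e21}; move: (qf T x1) (qf T x2) (sform T x1 x2) => a b z.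
case: w z => [w w'] [z z']; rewrite /nsq !cReImE /= => q1 q2 wz w1.
suff : 0 < (1 - t) ^+ 2 * a + t ^+ 2 * ((w ^+ 2 + w' ^+ 2) * b) +
            2 * (t * (1 - t) * (w * z - w' * z')).
  by apply: etrans; congr (_ < _); ring.
rewrite w1 mul1r.
have h0 : 0 <= t * (1 - t) * (w * z - w' * z').
  by rewrite !mulr_ge0 // subr_ge0.
have [->|tn] := eqVneq t 0; first by lra.
have : 0 < t ^+ 2 * b by rewrite mulr_gt0 // exprn_gt0 // lt_neqAle eq_sym tn.
have : 0 <= (1 - t) ^+ 2 * a by rewrite mulr_ge0 ?sqr_ge0 // ltW.
lra.
Qed.

(** * Connectedness of the violating quadruples *)

(** The violating quadruples are those with [disc > 0]. Both [disc] and [gap] are multiplied through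
    by squared norms, so that nothing has to be kept normalised along a segment. *)
Definition disc m (A B D : 'M[C]_m) x y v w : R :=
  nsq (sform B v w) * (nrm x * nrm y) - qf A x * qf D y * (nrm v * nrm w).
Definition gap m (x y v w : 'cV[C]_m) : R :=
  nsq (ip x v) * (nrm y * nrm w) - nsq (ip y w) * (nrm x * nrm v).

Lemma gapZ m a b c d (x y v w : 'cV[C]_m) :
  gap (a *: x) (b *: y) (c *: v) (d *: w) =
  nsq a * nsq b * nsq c * nsq d * gap x y v w.
Proof. by rewrite /gap !ipZl !ipZr !nsqM !nsqJ !nrmZ; ring. Qed.

Lemma gapC m (x y v w : 'cV[C]_m) : gap y x w v = - gap x y v w.
Proof. by rewrite /gap; ring. Qed.

Lemma discZ m a b c d (A B D : 'M[C]_m) x y v w :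
  disc A B D (a *: x) (b *: y) (c *: v) (d *: w) =
  nsq a * nsq b * nsq c * nsq d * disc A B D x y v w.
Proof. by rewrite /disc sformZl sformZr !qfZ !nrmZ !nsqM nsqJ; ring. Qed.

Lemma discC m (A B D : 'M[C]_m) x y v w :
  disc D (adj B) A y x w v = disc A B D x y v w.
Proof. by rewrite /disc -sformJ nsqJ; ring. Qed.

Lemma continuous_gap m (x y v w : R -> 'cV[C]_m) :
  mcont x -> mcont y -> mcont v -> mcont w ->
  continuous (fun t => gap (x t) (y t) (v t) (w t)).
Proof.
move=> hx hy hv hw; rewrite /gap.
by apply: fun_contD; last apply: fun_contN; apply: fun_contM;
  (try by apply: ccont_nsq; exact: ccont_ip); apply: fun_contM; exact: continuous_nrm.
Qed.

Lemma continuous_disc m (A B D : R -> 'M[C]_m) x y v w :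
  mcont A -> mcont B -> mcont D ->
  continuous (fun t => disc (A t) (B t) (D t) x y v w).
Proof.
move=> hA hB hD; rewrite /disc.
apply: fun_contD; last apply: fun_contN; apply: fun_contM.
- by apply: ccont_nsq; apply: ccont_sform => //; exact: mcont_cst.
- by move=> t; exact: cvg_cst.
- by apply: fun_contM; apply: continuous_qf => //; exact: mcont_cst.
- by move=> t; exact: cvg_cst.
Qed.

Lemma qfD n (X Y : 'M[C]_n) x : qf (X + Y) x = qf X x + qf Y x.
Proof. by rewrite /qf sformXD cReD. Qed.
Lemma qfN n (X : 'M[C]_n) x : qf (- X) x = - qf X x.
Proof. by rewrite /qf sformXN cReN. Qed.
Lemma qfXZ n (a : R) (X : 'M[C]_n) x : qf (a%:C *: X) x = a * qf X x.
Proof. by rewrite /qf sformXZ cReM /= mul0r subr0. Qed.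
Lemma qf_scalar n (a : R) (x : 'cV[C]_n) : qf a%:C%:M x = a * nrm x.
Proof. by rewrite -[_%:M]mulmx1 mul_scalar_mx qfXZ /qf sform1. Qed.

Lemma sform_block m n p q (A : 'M[C]_(m, p)) (B : 'M[C]_(m, q))
    (A' : 'M[C]_(n, p)) (B' : 'M[C]_(n, q)) v w v' w' :
  sform (block_mx A B A' B') (col_mx v w) (col_mx v' w') =
  (sform A v v' + sform B v w') + (sform A' w v' + sform B' w w').
Proof.
by rewrite /sform /ip mul_block_col adj_col_mx mul_row_col !mulmxDr !mxE.
Qed.

Section Sign.
Variables (m : nat) (A B D : 'M[C]_m).
Hypotheses (psdA : psd A) (psdD : psd D).
Hypothesis gap_neq0 : forall x y v w, 0 < disc A B D x y v w -> gap x y v w != 0.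

Let A0 x : 0 <= qf A x. Proof. by have /psdP[_] := psdA. Qed.
Let D0 x : 0 <= qf D x. Proof. by have /psdP[_] := psdD. Qed.

Lemma disc_gt0 x y v w : 0 < disc A B D x y v w ->
  [/\ 0 < nsq (sform B v w), 0 < nrm x, 0 < nrm y, 0 < nrm v & 0 < nrm w].
Proof.
move=> h.
have {}h : 0 < nsq (sform B v w) * (nrm x * nrm y).
  rewrite -subr_gt0 subr0; apply: lt_le_trans h _; rewrite /disc lerBlDr lerDl.
  by rewrite !mulr_ge0 ?nrm_ge0.
have nz z : z != 0 -> 0 < nrm z by move=> ?; exact: nrm_gt0.
split.
- rewrite lt_neqAle nsq_ge0 andbT eq_sym; apply: contraTneq h => ->.
  by rewrite mul0r ltxx.
- by apply: nrm_gt0; apply: contraTneq h => ->; rewrite nrm0 mul0r mulr0 ltxx.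
- by apply: nrm_gt0; apply: contraTneq h => ->; rewrite nrm0 !mulr0 ltxx.
- by apply: nrm_gt0; apply: contraTneq h => ->; rewrite sform0l nsq0 mul0r ltxx.
- by apply: nrm_gt0; apply: contraTneq h => ->; rewrite sform0r nsq0 mul0r ltxx.
Qed.

(** With [y], [v], [w] fixed, [disc] is a Hermitian form in [x], and [hermitian_cone_sign] connects
    the two points. *)
Lemma gap_sign_x x1 x2 y v w :
  0 < disc A B D x1 y v w -> 0 < disc A B D x2 y v w ->
  (0 < gap x1 y v w) = (0 < gap x2 y v w).
Proof.
pose T := (nsq (sform B v w) * nrm y)%:C%:M - (qf D y * (nrm v * nrm w))%:C *: A.
have e x : disc A B D x y v w = qf T x.
  by rewrite /T qfD qfN qfXZ qf_scalar /disc; ring.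
rewrite !e; apply: (@hermitian_cone_sign _ T (fun x => gap x y v w)).
- by have [hA _] := psdA; rewrite adjB adj_scale adj_scalar !conjc_real hA.
- move=> a b; exact: (continuous_gap (mcont_segment a b) (mcont_cst y)
    (mcont_cst v) (mcont_cst w)).
- by move=> a x a1; have := gapZ a 1 1 1 x y v w;
    rewrite !scale1r a1 /nsq /= expr1n expr0n addr0 !mulr1 mul1r.
- by move=> x; rewrite -e; exact: gap_neq0.
Qed.

Lemma gap_sign_y x y1 y2 v w :
  0 < disc A B D x y1 v w -> 0 < disc A B D x y2 v w ->
  (0 < gap x y1 v w) = (0 < gap x y2 v w).
Proof.
pose T := (nsq (sform B v w) * nrm x)%:C%:M - (qf A x * (nrm v * nrm w))%:C *: D.
have e y : disc A B D x y v w = qf T y.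
  by rewrite /T qfD qfN qfXZ qf_scalar /disc; ring.
rewrite !e; apply: (@hermitian_cone_sign _ T (fun y => gap x y v w)).
- by have [hD _] := psdD; rewrite adjB adj_scale adj_scalar !conjc_real hD.
- move=> a b; exact: (continuous_gap (mcont_cst x) (mcont_segment a b)
    (mcont_cst v) (mcont_cst w)).
- by move=> a y a1; have := gapZ 1 a 1 1 x y v w;
    rewrite !scale1r a1 /nsq /= expr1n expr0n addr0 !mulr1 mul1r.
- by move=> y; rewrite -e; exact: gap_neq0.
Qed.

(* [disc] is not a Hermitian form in the pair [(v, w)], but for suitably
   rescaled pairs its positivity is that of the form [2 Re v*Bw - s(|v|^2+|w|^2)]. *)
Lemma gap_sign_vw x y v1 w1 v2 w2 :
  0 < disc A B D x y v1 w1 -> 0 < disc A B D x y v2 w2 ->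
  (0 < gap x y v1 w1) = (0 < gap x y v2 w2).
Proof.
move=> d1 d2; have [_ nx ny _ _] := disc_gt0 d1.
have k0 : 0 < nrm x * nrm y by exact: mulr_gt0.
(* With [x] and [y] fixed, violation means that [nsq (sform B v w)] exceeds
   [s ^+ 2 * (nrm v * nrm w)]. *)
pose s := Num.sqrt (qf A x * qf D y / (nrm x * nrm y)).
have s0 : 0 <= s by exact: sqrtr_ge0.
have s2 : s ^+ 2 * (nrm x * nrm y) = qf A x * qf D y.
  rewrite sqr_sqrtr ?divfK ?gt_eqF // divr_ge0 ?(ltW k0) //; exact: mulr_ge0.
clearbody s.
pose T := block_mx (- s)%:C%:M B (adj B) (- s)%:C%:M.
have qT v w : qf T (col_mx v w) = 2 * Re (sform B v w) - s * (nrm v + nrm w).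
  rewrite /qf sform_block !cReD -/(qf _ v) -/(qf _ w) !qf_scalar.
  by rewrite -[sform (adj B) w v]sformJ cReJ; ring.
(* By the inequality of arithmetic and geometric means, [s * (nrm v + nrm w)] is at least
   [2 * s * sqrt (nrm v * nrm w)]. *)
have T_disc v w : 0 < qf T (col_mx v w) -> 0 < disc A B D x y v w.
  rewrite qT subr_gt0 => h; rewrite /disc subr_gt0 -s2 mulrAC ltr_pM2r //.
  have h1 : (s * (nrm v + nrm w)) ^+ 2 < (2 * Re (sform B v w)) ^+ 2.
    rewrite ltr_pXn2r // nnegrE; first by rewrite mulr_ge0 // addr_ge0 // nrm_ge0.
    by apply: le_trans (ltW h); rewrite mulr_ge0 // addr_ge0 // nrm_ge0.
  rewrite /nsq; have := sqr_ge0 (Im (sform B v w)).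
  have : 0 <= (s * (nrm v - nrm w)) ^+ 2 by exact: sqr_ge0.
  move: h1; rewrite !exprMn; move: (s ^+ 2) (Re _ ^+ 2) (Im _ ^+ 2) => S r i.
  rewrite !expr2; lra.
(* With both vectors scaled to norm one the two means agree, and turning the phase of [w] makes
   [sform B v w] real and nonnegative; violation then makes [T] positive. *)
have normalize v w : 0 < disc A B D x y v w ->
    exists a b, [/\ 0 < nsq a, 0 < nsq b & 0 < qf T (col_mx (a *: v) (b *: w))].
  move=> d; have [nB _ _ nv nw] := disc_gt0 d.
  have [p [p1 p2]] := align_phase (sform B v w).
  pose al := (Num.sqrt (nrm v))^-1; pose be := (Num.sqrt (nrm w))^-1.
  have al0 : 0 < al by rewrite invr_gt0 sqrtr_gt0.
  have be0 : 0 < be by rewrite invr_gt0 sqrtr_gt0.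
  have al2 : al ^+ 2 * nrm v = 1.
    by rewrite exprVn sqr_sqrtr ?nrm_ge0 // mulVf // gt_eqF.
  have be2 : be ^+ 2 * nrm w = 1.
    by rewrite exprVn sqr_sqrtr ?nrm_ge0 // mulVf // gt_eqF.
  have nr (r : R) : nsq r%:C = r ^+ 2 by rewrite /nsq /= expr0n addr0.
  exists al%:C, (be%:C * p); rewrite nsqM p1 mulr1 !nr !exprn_gt0 //; split=> //.
  rewrite qT !nrmZ nsqM p1 mulr1 !nr al2 be2 sformZl sformZr conjc_real -mulrA p2.
  rewrite -!rmorphM /=.
  have : s ^+ 2 < (al * (be * Num.sqrt (nsq (sform B v w)))) ^+ 2.
    rewrite !exprMn sqr_sqrtr ?nsq_ge0 //.
    move: d; rewrite /disc subr_gt0 -s2 mulrAC ltr_pM2r // => d.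
    rewrite -(ltr_pM2r (mulr_gt0 nv nw)).
    suff -> : al ^+ 2 * (be ^+ 2 * nsq (sform B v w)) * (nrm v * nrm w) =
              (al ^+ 2 * nrm v) * (be ^+ 2 * nrm w) * nsq (sform B v w).
      by rewrite al2 be2 !mul1r.
    by ring.
  rewrite ltr_pXn2r ?nnegrE // => [|]; first by lra.
  by rewrite !mulr_ge0 ?sqrtr_ge0 ?ltW.
have [a1 [b1 [na1 nb1 q1]]] := normalize _ _ d1.
have [a2 [b2 [na2 nb2 q2]]] := normalize _ _ d2.
have gz a b v w : 0 < nsq a -> 0 < nsq b ->
    (0 < gap x y (a *: v) (b *: w)) = (0 < gap x y v w).
  move=> na nb; have := gapZ 1 1 a b x y v w; rewrite !scale1r => ->.
  by rewrite /nsq /= expr1n expr0n addr0 !mul1r pmulr_rgt0 // mulr_gt0.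
rewrite -(gz a1 b1 v1) // -(gz a2 b2 v2) //.
pose P (u : 'cV[C]_(m + m)) := gap x y (usubmx u) (dsubmx u).
have := @hermitian_cone_sign _ T P _ _ _ _ _ _ q1 q2.
rewrite /P !col_mxKu !col_mxKd; apply.
- by rewrite adj_block_mx !adj_scalar !conjc_real adjK.
- move=> u u'; apply: continuous_gap; try exact: mcont_cst.
    by move=> i j; under eq_fun do rewrite mxE; exact: mcont_segment.
  by move=> i j; under eq_fun do rewrite mxE; exact: mcont_segment.
- move=> a u a1'.
  have := gapZ 1 1 a a x y (usubmx u) (dsubmx u).
  rewrite !scale1r a1' /nsq /= expr1n expr0n addr0 !mul1r => <-.
  by rewrite -[u in LHS]vsubmxK scale_col_mx col_mxKu col_mxKd.
- by move=> u; rewrite -[u in qf _ u]vsubmxK => /T_disc; exact: gap_neq0.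
Qed.

(** Each inequality bounds [q * (a / n)] by [p], so the smaller of the two ratios [a / n] satisfies
    both. The ratios will be Rayleigh quotients, and one vector thus passes from one violating
    quadruple to the other. *)
Lemma exchange_lt (p1 q1 n1 a1 p2 q2 n2 a2 : R) :
  0 <= q1 -> 0 <= q2 -> 0 < n1 -> 0 < n2 ->
  q1 * a1 < p1 * n1 -> q2 * a2 < p2 * n2 ->
  q1 * a2 < p1 * n2 \/ q2 * a1 < p2 * n1.
Proof.
move=> q10 q20 n10 n20 h1 h2; have [h|h] := leP (a2 * n1) (a1 * n2).
  left; rewrite -(ltr_pM2r n10); apply: le_lt_trans (_ : q1 * a1 * n2 < _).
    by rewrite -!mulrA ler_wpM2l.
  by rewrite [ltRHS]mulrAC ltr_pM2r.
right; rewrite -(ltr_pM2r n20); apply: le_lt_trans (_ : q2 * a2 * n1 < _).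
  by rewrite -!mulrA ler_wpM2l // ltW.
by rewrite [ltRHS]mulrAC ltr_pM2r.
Qed.

(** Two violating quadruples are joined through violating ones: [exchange_lt] makes [x] common, then
    [y], after which only the pair [(v, w)] differs. *)
Lemma gap_sign x1 y1 v1 w1 x2 y2 v2 w2 :
  0 < disc A B D x1 y1 v1 w1 -> 0 < disc A B D x2 y2 v2 w2 ->
  (0 < gap x1 y1 v1 w1) = (0 < gap x2 y2 v2 w2).
Proof.
have same_xy x y v w v' w' : 0 < disc A B D x y v w -> 0 < disc A B D x y v' w' ->
    (0 < gap x y v w) = (0 < gap x y v' w') by exact: gap_sign_vw.
have same_x x y v w y' v' w' :
    0 < disc A B D x y v w -> 0 < disc A B D x y' v' w' ->
    (0 < gap x y v w) = (0 < gap x y' v' w').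
  move=> d d'; have [_ _ ny _ _] := disc_gt0 d; have [_ _ ny' _ _] := disc_gt0 d'.
  have E2 y0 v0 w0 : (0 < disc A B D x y0 v0 w0) =
      (qf A x * (nrm v0 * nrm w0) * qf D y0 < nsq (sform B v0 w0) * nrm x * nrm y0).
    by rewrite /disc subr_gt0; congr (_ < _); ring.
  move: (d) (d'); rewrite !E2 => /exchange_lt h /h [] //; rewrite -?E2.
  - by rewrite !mulr_ge0 ?nrm_ge0.
  - by rewrite !mulr_ge0 ?nrm_ge0.
  - by move=> d1; rewrite (gap_sign_y d d1); exact: same_xy.
  - by move=> d1; rewrite (gap_sign_y d' d1); exact: same_xy.
move=> d d'; have [_ nx _ _ _] := disc_gt0 d; have [_ nx' _ _ _] := disc_gt0 d'.
have E x y v w : (0 < disc A B D x y v w) =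
    (qf D y * (nrm v * nrm w) * qf A x < nsq (sform B v w) * nrm y * nrm x).
  by rewrite /disc subr_gt0; congr (_ < _); ring.
move: (d) (d'); rewrite !E => /exchange_lt h /h [] //; rewrite -?E.
- by rewrite !mulr_ge0 ?nrm_ge0.
- by rewrite !mulr_ge0 ?nrm_ge0.
- by move=> d1; rewrite (gap_sign_x d d1); exact: same_x.
- by move=> d1; rewrite (gap_sign_x d' d1); exact: same_x.
Qed.

End Sign.

(** * Rotating the orthonormal pair *)

Definition combo n m (E0 E1 : 'M[C]_(n, m)) (c s : R) := c%:C *: E0 + s%:C *: E1.

Definition rdisc n m (rho : 'M[C]_n) (E0 E1 : 'M[C]_(n, m)) :=
  disc (adj E0 *m rho *m E0) (adj E0 *m rho *m E1) (adj E1 *m rho *m E1).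

(** The quarter turn replaces the blocks [A], [B], [D] by [D], [- adj B], [A]. The sign is invisible
    to [disc], and the exchange of blocks is [discC]. *)
Lemma rdisc_flip n m (rho : 'M[C]_n) (E0 E1 : 'M[C]_(n, m)) x y v w :
  adj rho = rho ->
  rdisc rho E1 (- E0) x y v w = rdisc rho E0 E1 y x w v.
Proof.
move=> hr; rewrite /rdisc -[RHS]discC.
have -> : adj (adj E0 *m rho *m E1) = adj E1 *m rho *m E0.
  by rewrite !adjM adjK hr mulmxA.
rewrite adjN !mulmxN !mulNmx opprK /disc.
by rewrite sformXN nsqN.
Qed.

(** If every angle had a violating quadruple, the common sign of [gap] on such quadruples would be a
    continuous function of the angle without zeros, yet take opposite values at [0] and [pi / 2]. *)
Lemma exists_rotation n m (rho : 'M[C]_n) (E0 E1 : 'M[C]_(n, m)) :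
  psd rho ->
  (forall c s, c ^+ 2 + s ^+ 2 = 1 -> forall x y v w,
     0 < rdisc rho (combo E0 E1 c s) (combo E0 E1 (- s) c) x y v w ->
     gap x y v w != 0) ->
  exists c s, c ^+ 2 + s ^+ 2 = 1 /\ forall x y v w,
    rdisc rho (combo E0 E1 c s) (combo E0 E1 (- s) c) x y v w <= 0.
Proof.
move=> prho hgap; apply: contrapT => hno.
pose F t := rdisc rho (combo E0 E1 (cos t) (sin t)) (combo E0 E1 (- sin t) (cos t)).
have cs1 t := cos2Dsin2 t.
have Fgap t x y v w : 0 < F t x y v w -> gap x y v w != 0 by apply: hgap.
have Fsign t x y v w x' y' v' w' : 0 < F t x y v w -> 0 < F t x' y' v' w' ->
    (0 < gap x y v w) = (0 < gap x' y' v' w').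
  apply: gap_sign; [exact: psd_conj|exact: psd_conj|exact: Fgap].
have Fex t : exists Q : 'cV[C]_m * 'cV[C]_m * 'cV[C]_m * 'cV[C]_m,
    0 < F t Q.1.1.1 Q.1.1.2 Q.1.2 Q.2.
  apply: contrapT => h; apply: hno; exists (cos t), (sin t); split=> // x y v w.
  by rewrite leNgt; apply/negP => h'; apply: h; exists (x, y, v, w).
have Fcont x y v w : continuous (fun t => F t x y v w).
  have cE a b : continuous a -> continuous b ->
      mcont (fun t => combo E0 E1 (a t) (b t)).
    by move=> ha hb; apply: mcontD; apply: mcontZ => //; exact: mcont_cst.
  have cc := @continuous_cos R; have csn := @continuous_sin R.
  have cE0 := cE _ _ cc csn; have cE1 := cE _ _ (fun_contN csn) cc.
  apply: continuous_disc; apply: mcontM => //; apply: mcontM; try exact: mcont_cst;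
    by exact: mcont_adj.
(* By [gap_sign], any violating quadruple at angle [t] computes [sg t], so quadruples need not be
   chosen continuously in [t]. *)
pose sg t : R := if `[< exists Q : 'cV[C]_m * 'cV[C]_m * 'cV[C]_m * 'cV[C]_m,
    0 < F t Q.1.1.1 Q.1.1.2 Q.1.2 Q.2 /\ 0 < gap Q.1.1.1 Q.1.1.2 Q.1.2 Q.2 >]
  then 1 else -1.
have sgE t x y v w : 0 < F t x y v w -> sg t = if 0 < gap x y v w then 1 else -1.
  move=> h; rewrite /sg; case: asboolP => [[Q [hQ gQ]]|hn].
    by rewrite -(Fsign _ _ _ _ _ _ _ _ _ hQ h) gQ.
  by case: ifP => // g; case: hn; exists (x, y, v, w).
(* A quadruple that violates at [t] still violates at nearby angles, so [sg] is locally constant. *)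
have sg_cont : continuous sg.
  move=> t; have [[[[x y] v] w] /= hQ] := Fex t.
  apply: (@cvg_near_cst R R (sg t) sg (nbhs t) (nbhs_filter t)).
  have near_t := cvgr_gt _ (Fcont x y v w t) _ hQ.
  near=> u; have hu : 0 < F u x y v w by near: u; exact: near_t.
  by rewrite (sgE _ _ _ _ _ hu) (sgE _ _ _ _ _ hQ).
have sg_neq0 t : sg t != 0 by rewrite /sg; case: ifP => _; rewrite ?oppr_eq0 oner_eq0.
have := continuous_sign (le_trans ler01 (pihalf_ge1 R)) sg_cont (fun t _ => sg_neq0 t).
have [[[[x y] v] w] /= h0] := Fex 0.
(* At [pi / 2] the pair is [(E1, - E0)], so the quadruple violating at [0] violates there once [x],
   [y] and [v], [w] are exchanged. *)
have h1 : 0 < F (pi / 2) y x w v.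
  have hr : adj rho = rho by have [] := prho.
  move: h0; rewrite /F cos_pihalf sin_pihalf cos0 sin0.
  have -> : combo E0 E1 0 1 = E1 by rewrite /combo scale0r scale1r add0r.
  have -> : combo E0 E1 (- 1) 0 = - E0.
    by rewrite /combo scale0r addr0 rmorphN1 scaleN1r.
  have -> : combo E0 E1 1 0 = E0 by rewrite /combo scale0r scale1r addr0.
  have -> : combo E0 E1 (- 0) 1 = E1 by rewrite /combo oppr0 scale0r scale1r add0r.
  by rewrite rdisc_flip.
rewrite (sgE _ _ _ _ _ h0) (sgE _ _ _ _ _ h1) [gap y x w v]gapC oppr_gt0.
have := Fgap _ _ _ _ _ h0.
by case: (ltgtP (gap x y v w) 0) => [_|_|_]; rewrite ?eqxx ?ltr01 ?oppr_gt0 ?ltr10.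
Unshelve. all: by end_near.
Qed.

(** * Consequences of the partial transpose criterion *)

Lemma unitaryM n (U V : 'M[C]_n) : unitary U -> unitary V -> unitary (U *m V).
Proof. by move=> hU hV; rewrite /unitary adjM !mulmxA -(mulmxA U) hV mulmx1. Qed.

Lemma unitary1 n : unitary (1%:M : 'M[C]_n).
Proof. by rewrite /unitary adj1 mulmx1. Qed.

Lemma ip_unitary n (U : 'M[C]_n) x y : unitary U -> ip (U *m x) (U *m y) = ip x y.
Proof. by move=> /unitaryC hU; rewrite ip_adj mulmxA hU mul1mx. Qed.

Lemma ipBl n (x1 x2 y : 'cV[C]_n) : ip (x1 - x2) y = ip x1 y - ip x2 y.
Proof. by rewrite ipDl ipNl. Qed.

Lemma proj_proj n (u : 'cV[C]_n) : proj u *m proj u = (nrm u)%:C *: proj u.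
Proof. by rewrite {2}/proj mulmxA proj_mul ip_nrm -scalemxAl. Qed.

(* Complex Householder reflection [1 - u u^* / (u^* a)] with [u = a - b]. *)
Lemma unitary_sends n (a b : 'cV[C]_n) : nrm a = nrm b ->
  exists U : 'M[C]_n, [/\ unitary U, U *m a = b &
    forall z, ip (a - b) z = 0 -> U *m z = z].
Proof.
move=> ab; have [->|neq] := eqVneq a b.
  by exists 1%:M; split=> [||z _]; rewrite ?mul1mx //; exact: unitary1.
set u := a - b; pose t := ip u a.
have u0 : nrm u != 0.
  by apply: contraNneq neq => /nrm_eq0 /eqP; rewrite subr_eq0.
(* The equality of norms enters here; this identity makes the reflection unitary and its denominator
   [t] nonzero. *)
have ut : (nrm u)%:C = t + conjc t.
  rewrite -ip_nrm /t ipJ {2}/u ipDr ipNr; congr (_ + _).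
  rewrite ipBl /u ipDr ipNr !ip_nrm ab; ring.
have t0 : t != 0.
  apply: contraNneq u0 => t0; apply/eqP/complexI.
  by rewrite ut t0 rmorph0 addr0.
have Ut z : (1%:M - t^-1 *: proj u) *m z = z - (t^-1 * ip u z) *: u.
  by rewrite mulmxBl mul1mx -scalemxAl proj_mul scalerA.
exists (1%:M - t^-1 *: proj u); split=> [||z hz].
- rewrite /unitary adjB adj1 adj_scale adj_proj mulmxBl mul1mx mulmxBr mulmx1.
  rewrite -scalemxAl -scalemxAr proj_proj !scalerA ut.
  rewrite opprB addrA -[RHS]addr0 -!addrA; congr (_ + _).
  rewrite -!scaleNr -!scalerDl; set k := (X in X *: _).
  suff -> : k = 0 by rewrite scale0r.
  have tc0 : conjc t != 0 by rewrite conjc_eq0.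
  rewrite /k conjc_inv; field; first by rewrite t0 tc0.
- by rewrite Ut -/t mulVf // scale1r /u opprB addrCA subrr addr0.
- by rewrite Ut hz mulr0 scale0r subr0.
Qed.

(** A first reflection sends [x] to [w]. The second sends the image of [v] to [y] and fixes [w],
    since equal inner products make its reflecting vector orthogonal to [w]. *)
Lemma unitary_sends2 n (x v w y : 'cV[C]_n) :
  nrm x = nrm w -> nrm v = nrm y -> ip x v = ip w y ->
  exists U : 'M[C]_n, [/\ unitary U, U *m x = w & U *m v = y].
Proof.
move=> /unitary_sends[U1 [hU1 Ux _]] vy xv.
have [|U2 [hU2 Uv Uw]] := @unitary_sends _ (U1 *m v) y; first by rewrite nrm_unitary.
exists (U2 *m U1); split; first exact: unitaryM.
  rewrite -mulmxA Ux Uw // ipBl -[ip (U1 *m v) w]ipJ -[ip y w]ipJ -xv -Ux ip_unitary //.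
  by rewrite subrr.
by rewrite -mulmxA.
Qed.

(** The form equals [a * (a * c - r ^+ 2)] at [(s, t) = (r, a)]. If [a = 0] and [r] is nonzero, it
    equals [-1] at [((c + 1) / (2 * r), 1)]. *)
Lemma sqr_le_of_quadratic (a c r : R) : 0 <= a ->
  (forall s t, 0 <= s ^+ 2 * a + t ^+ 2 * c - 2 * (s * t * r)) -> r ^+ 2 <= a * c.
Proof.
move=> a0 h; have [e|an] := eqVneq a 0.
  have [->|rn] := eqVneq r 0; first by rewrite e mul0r expr0n.
  have := h ((c + 1) / (2 * r)) 1; rewrite e.
  have -> : 2 * ((c + 1) / (2 * r) * 1 * r) = c + 1 by field.
  by rewrite mulr0 expr1n; lra.
have ap : 0 < a by rewrite lt_neqAle eq_sym an.
have := h r a.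
have -> : r ^+ 2 * a + a ^+ 2 * c - 2 * (r * a * r) = a * (a * c - r ^+ 2) by ring.
by rewrite pmulr_rge0 // subr_ge0.
Qed.

Section Pair.
Variables (n m : nat) (rho : 'M[C]_n) (E F : 'M[C]_(n, m)).
Hypothesis EE : adj E *m E = 1%:M.
Hypothesis EF : adj E *m F = 0.
Hypothesis prho : psd rho.
(* The partial transposes of all [U rho U^*], tested on [span (E, F)]. *)
Hypothesis pt_ge0 : forall U : 'M[C]_n, unitary U -> forall z0 z1,
  let sigma := U *m rho *m adj U in
  0 <= qf sigma (E *m z0) + qf sigma (F *m z1)
       + 2 * Re (sform sigma (E *m z1) (F *m z0)).

(** A unitary [U] sending [x] to [w] and [v] to [y] is extended to [W], acting on the range of [E]
    and trivially on its orthogonal complement. Testing at [(w, y)] and undoing [W] turns [E w],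
    [E y] into [E x], [E v] and leaves the range of [F] fixed. *)
Lemma gram_ineq x v w y : nrm x = nrm w -> nrm v = nrm y -> ip x v = ip w y ->
  0 <= qf (adj E *m rho *m E) x + qf (adj F *m rho *m F) y
       + 2 * Re (sform (adj E *m rho *m F) v w).
Proof.
move=> xw vy xv; have [U [hU Ux Uv]] := unitary_sends2 xw vy xv.
have hU' := unitaryC hU.
have {Ux}Ux : adj U *m w = x by rewrite -Ux mulmxA hU' mul1mx.
have {Uv}Uv : adj U *m y = v by rewrite -Uv mulmxA hU' mul1mx.
pose W := 1%:M + E *m (U - 1%:M) *m adj E.
have WE : adj W = 1%:M + E *m (adj U - 1%:M) *m adj E.
  by rewrite /W adjD adj1 !adjM adjK adjB adj1 mulmxA.
have hW : unitary W.
  have DD : adj U - 1%:M + ((U - 1%:M) + (U - 1%:M) *m (adj U - 1%:M)) = 0.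
    rewrite mulmxBl mul1mx mulmxBr mulmx1 hU -(opprB U 1%:M).
    by rewrite [X in _ + X]addrA subrr add0r subrr.
  rewrite /unitary WE /W; move: DD; move: (U - 1%:M) (adj U - 1%:M) => D D' DD.
  rewrite mulmxDl mul1mx [X in _ + X]mulmxDr mulmx1 -[RHS]addr0 -addrA.
  congr (_ + _).
  have -> : E *m D *m adj E *m (E *m D' *m adj E) = E *m (D *m D') *m adj E.
    by rewrite !mulmxA -(mulmxA _ (adj E) E) EE mulmx1.
  by rewrite -!mulmxDl -!mulmxDr DD mulmx0 mul0mx.
have WE' z : adj W *m (E *m z) = E *m (adj U *m z).
  rewrite WE mulmxDl mul1mx !mulmxA -(mulmxA _ (adj E) E) EE mulmx1.
  by rewrite mulmxBr mulmx1 mulmxBl addrC subrK.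
have WF z : adj W *m (F *m z) = F *m z.
  by rewrite WE mulmxDl mul1mx -!mulmxA (mulmxA (adj E) F) EF mul0mx !mulmx0 addr0.
have := pt_ge0 hW w y => /=.
have sW a b : sform (W *m rho *m adj W) a b = sform rho (adj W *m a) (adj W *m b).
  by rewrite -{1}[W]adjK sform_mul.
by rewrite /qf !sW !WE' !WF Ux Uv -!sform_mul.
Qed.

(** If the gap vanished, a phase on [v] would give the equality of inner products in [gram_ineq].
    Scaling the vectors then yields a nonnegative quadratic form in two real variables, and its
    discriminant bound contradicts the violation. *)
Lemma gap_neq0_of_pt x y v w : 0 < rdisc rho E F x y v w -> gap x y v w != 0.
Proof.
move=> d.
have pA : psd (adj E *m rho *m E) by exact: psd_conj.
have pD : psd (adj F *m rho *m F) by exact: psd_conj.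
have [_ nx ny nv nw] := disc_gt0 pA pD d.
have nrm_unit (z : 'cV[C]_m) : 0 < nrm z ->
    exists r : R, 0 < nsq r%:C /\ nrm (r%:C *: z) = 1.
  move=> nz; exists (Num.sqrt (nrm z))^-1.
  rewrite nrmZ /nsq /= expr0n addr0 exprVn sqr_sqrtr ?ltW // mulVf ?gt_eqF //.
  by rewrite invr_gt0.
have [a [na ax]] := nrm_unit _ nx; have [b [nb byy]] := nrm_unit _ ny.
have [c [nc cv]] := nrm_unit _ nv; have [k [nk kw]] := nrm_unit _ nw.
move: d; rewrite /rdisc -(pmulr_rgt0 _ (mulr_gt0 (mulr_gt0 (mulr_gt0 na nb) nc) nk)).
rewrite -discZ => d; apply/eqP => g0.
have : gap (a%:C *: x) (b%:C *: y) (c%:C *: v) (k%:C *: w) = 0.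
  by rewrite gapZ g0 mulr0.
move: d ax byy cv kw; move: (_ *: x) (_ *: y) (_ *: v) (_ *: w).
move=> {x y v w a b c k nx ny nv nw na nb nc nk g0} x y v w d nx ny nv nw.
rewrite /gap nx ny nv nw !mulr1 => /eqP; rewrite subr_eq0 => /eqP g.
have [p1 [np1 hp1]] := align_phase (ip x v).
have [p2 [np2 hp2]] := align_phase (ip w y).
have gJ : nsq (ip w y) = nsq (ip x v) by rewrite g -ipJ nsqJ.
(* The moduli of [ip x v] and [ip w y] agree because the gap is zero; [om] corrects the phase. *)
pose om := conjc p2 * p1.
have nom : nsq om = 1 by rewrite nsqM nsqJ np1 np2 mulr1.
have xv : ip x (om *: v) = ip w y.
  rewrite ipZr /om -mulrA hp1 -gJ -hp2 mulrA [conjc _ * _]mulrC -nsqE np2.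
  by rewrite mul1r.
clearbody om.
set z := sform (adj E *m rho *m F) (om *: v) w.
have [p [np hp]] := align_phase z.
move: d; rewrite /disc nx ny nv nw !mulr1 ltNge subr_le0; case/negP.
have -> : nsq (sform (adj E *m rho *m F) v w) = Num.sqrt (nsq z) ^+ 2.
  by rewrite sqr_sqrtr ?nsq_ge0 // /z sformZl nsqM nsqJ nom mul1r.
apply: sqr_le_of_quadratic; first by have /psdP[_] := pA.
move=> s t.
have nr (r : R) : nsq r%:C = r ^+ 2 by rewrite /nsq /= expr0n addr0.
(* The factor [- conjc p] turns the cross term into [- (s * t)] times the modulus of [z]; [y]
   carries it too, which keeps the inner products equal. *)
have := @gram_ineq (s%:C *: x) ((t%:C * - conjc p) *: (om *: v))
  (s%:C *: w) ((t%:C * - conjc p) *: y).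
rewrite !nrmZ !nsqM nom nx ny nv nw !nsqN nsqJ np !mulr1.
rewrite !ipZl !ipZr -[om * ip x v]ipZr xv.
move=> /(_ erefl erefl erefl); rewrite !qfZ nsqM !nr nsqN nsqJ np mulr1.
rewrite sformZl sformZr -/z.
have -> : conjc (t%:C * - conjc p) = - (t%:C * p).
  by apply: complexP; rewrite !cReImE /=; ring.
have -> : - (t%:C * p) * (s%:C * z) = - (s * t)%:C * (p * z).
  by rewrite rmorphM /=; ring.
rewrite hp mulNr -rmorphM cReN.
by rewrite [Re _]/= mulrN.
Qed.

End Pair.

(** * Lifting from a compression *)

(** [X] is a sum of dyads [proj u], and a vanishing form forces every [ip u x] to vanish. *)
Lemma psd_ker n (X : 'M[C]_n) x : psd X -> qf X x = 0 -> X *m x = 0.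
Proof.
move=> /psd_mixof[s [-> _]]; rewrite /qf sform_sum Re_sum => /eqP.
rewrite psumr_eq0 => [/allP h|u _]; last by rewrite -/(qf _ _) qf_proj nsq_ge0.
rewrite mulmx_suml big_seq big1 // => u us; rewrite proj_mul.
have /eqP := h u us; rewrite -/(qf _ _) qf_proj => /nsq_eq0 ->.
by rewrite scale0r.
Qed.

(** By a Schur complement, [rho] is its compression lifted by [G] plus a positive remainder
    annihilated by [adj J]. A ket [u] of the compression lifts to [G *m u], which compresses back to
    [u]. *)
Lemma mixof_lift n p (rho : 'M[C]_n) (J : 'M[C]_(n, p)) (P : 'cV[C]_p -> Prop) :
  psd rho -> adj J *m J = 1%:M -> mixof P (adj J *m rho *m J) ->
  mixof (fun psi => P (adj J *m psi) \/ adj J *m psi = 0) rho.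
Proof.
move=> prho JJ hP; have [hr _] := prho.
(* Solvable because, by [psd_ker], the kernel of the compression lies in that of [rho *m J]. *)
have [G0 hG0] : exists G0, rho *m J = G0 *m (adj J *m rho *m J).
  apply/submxP; rewrite submxE.
  move: (mulmx_coker (adj J *m rho *m J)); move: (cokermx _) => Z hZ.
  have e j : col j (rho *m J *m Z) = 0.
    rewrite colE -!mulmxA; apply: psd_ker => //.
    by rewrite /qf /sform ip_adj !mulmxA hZ mul0mx ip0r.
  apply/eqP/matrixP => i j; have /matrixP/(_ i 0) := e j.
  by rewrite [LHS]mxE => ->; rewrite !mxE.
(* The component of [G0] in the range of [J] is replaced by [J] itself, which enforces
   [adj J *m G = 1%:M]. *)
pose G := J + (1%:M - J *m adj J) *m G0.
have hG : rho *m J = G *m (adj J *m rho *m J).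
  rewrite /G [RHS]mulmxDl -[X in _ + X]mulmxA -hG0 mulmxBl mul1mx !mulmxA.
  by rewrite addrC subrK.
have JG : adj J *m G = 1%:M.
  by rewrite mulmxDr JJ mulmxA mulmxBr mulmx1 mulmxA JJ mul1mx subrr mul0mx addr0.
have hG' : adj J *m rho = adj J *m rho *m J *m adj G.
  have := congr1 (@adj R _ _) hG; rewrite !adjM adjK hr.
  by rewrite !mulmxA.
pose K := 1%:M - G *m adj J.
have GJ : adj G *m J = 1%:M by rewrite -[J]adjK -adjM JG adj1.
have -> : rho = G *m (adj J *m rho *m J) *m adj G + K *m rho *m adj K.
  have -> : K *m rho = rho - rho *m J *m adj G.
    by rewrite mulmxBl mul1mx -(mulmxA G) hG' mulmxA -hG.
  rewrite -hG /K adjB adj1 adjM adjK mulmxBr mulmx1 mulmxBl !mulmxA.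
  by rewrite -(mulmxA _ (adj G) J) GJ mulmx1 subrr subr0 addrC subrK.
apply: mixofD.
  by apply: mixof_conj hP => u Pu; left; rewrite mulmxA JG mul1mx.
apply: mixof_conj (psd_mixof prho) => u _; right.
by rewrite mulmxA /K mulmxBr mulmx1 mulmxA JG mul1mx subrr mul0mx.
Qed.

Lemma mixof_sub n (P Q : 'cV[C]_n -> Prop) X :
  (forall u, P u -> Q u) -> mixof P X -> mixof Q X.
Proof. by move=> PQ [s [-> hs]]; exists s; split=> // u /hs/PQ. Qed.

(** When [E0] and [E1] embed the slices at two basis vectors of one factor, the two blocks are two
    rows or two columns of the coefficient matrix of [psi]. *)
Definition parallel_rows n m (E0 E1 : 'M[C]_(n, m)) (psi : 'cV[C]_n) : Prop :=
  exists g0 g1 z, adj E0 *m psi = g0 *: z /\ adj E1 *m psi = g1 *: z.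

(** After a suitable rotation the compression is a mixture of product kets, which lifts to [rho].
    Proportionality of the two blocks survives the rotation back from [(E, F)] to [(E0, E1)]. *)
Lemma mixof_parallel n m (rho : 'M[C]_n) (E0 E1 : 'M[C]_(n, m.+1)) :
  psd rho ->
  adj E0 *m E0 = 1%:M -> adj E1 *m E1 = 1%:M -> adj E0 *m E1 = 0 ->
  (forall c s, c ^+ 2 + s ^+ 2 = 1 ->
   forall U : 'M[C]_n, unitary U -> forall z0 z1,
   let sigma := U *m rho *m adj U in
   let E := combo E0 E1 c s in let F := combo E0 E1 (- s) c in
   0 <= qf sigma (E *m z0) + qf sigma (F *m z1)
        + 2 * Re (sform sigma (E *m z1) (F *m z0))) ->
  mixof (parallel_rows E0 E1) rho.
Proof.
move=> prho h00 h11 h01 hpt.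
have h10 : adj E1 *m E0 = 0.
  by have := congr1 (@adj R _ _) h01; rewrite adjM adjK adj0.
have comboM a b c d : adj (combo E0 E1 a b) *m combo E0 E1 c d =
    (a * c + b * d)%:C%:M.
  rewrite /combo adjD !adj_scale !conjc_real mulmxDl !mulmxDr -!scalemxAl -!scalemxAr.
  rewrite h00 h11 h01 h10 !scaler0 addr0 add0r !scalerA -scalerDl -!rmorphM -rmorphD.
  by rewrite scalemx1.
have scal0 : (0 : R)%:C%:M = 0 :> 'M[C]_m.+1.
  by apply/matrixP => i j; rewrite !mxE mul0rn.
have [|c [s [cs hd]]] := @exists_rotation _ _ rho E0 E1 prho.
  move=> c s cs x y v w; apply: gap_neq0_of_pt => //.
  - by rewrite comboM -!expr2 cs.
  - by rewrite comboM mulrN [s * c]mulrC addNr scal0.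
  - exact: hpt.
set E := combo E0 E1 c s in hd; set F := combo E0 E1 (- s) c in hd.
have EE : adj E *m E = 1%:M by rewrite comboM -!expr2 cs.
have FF : adj F *m F = 1%:M by rewrite comboM mulrNN -!expr2 addrC cs.
have EF : adj E *m F = 0 by rewrite comboM mulrN [s * c]mulrC addNr scal0.
have FE : adj F *m E = 0 by rewrite comboM mulNr [s * c]mulrC addNr scal0.
have E0E : E0 = c%:C *: E - s%:C *: F.
  rewrite /E /F /combo !scalerDr !scalerA -!rmorphM mulrN rmorphN scaleNr.
  rewrite opprD opprK addrACA -scalerDl -rmorphD -!expr2 cs scale1r.
  by rewrite [s * c]mulrC subrr addr0.
have E1E : E1 = s%:C *: E + c%:C *: F.
  rewrite /E /F /combo !scalerDr !scalerA -!rmorphM mulrN rmorphN scaleNr.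
  rewrite addrACA -[X in _ + X]scalerDl -rmorphD -!expr2 addrC.
  by rewrite [s ^+ 2 + _]addrC cs scale1r [s * c]mulrC subrr addr0.
clearbody E F.
pose J := row_mx E F.
have JJ : adj J *m J = 1%:M.
  by rewrite adj_row_mx mul_col_row EE FF EF FE -scalar_mx_block.
have hJ : mixof (@prodket m.+1) (adj J *m rho *m J).
  have -> : adj J *m rho *m J = block_mx (adj E *m rho *m E) (adj E *m rho *m F)
      (adj (adj E *m rho *m F)) (adj F *m rho *m F).
    have [hr _] := prho.
    by rewrite adj_row_mx mul_col_mx mul_col_row !adjM adjK hr !mulmxA.
  apply: block_separable; [exact: psd_conj|exact: psd_conj|].
  by move=> x y v w; have := hd x y v w; rewrite /rdisc /disc subr_le0.
apply: mixof_sub (mixof_lift prho JJ hJ) => psi hpsi.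
have [g0 [g1 [z [eE eF]]]] : exists g0 g1 z,
    adj E *m psi = g0 *: z /\ adj F *m psi = g1 *: z.
  case: hpsi => [[g0 [g1 [z]]]|]; rewrite adj_row_mx mul_col_mx.
    by move=> /eq_col_mx[e1 e2]; exists g0, g1, z.
  rewrite -col_mx0 => /eq_col_mx[e1 e2]; exists 0, 0, 0.
  by rewrite !scale0r.
exists (c%:C * g0 - s%:C * g1), (s%:C * g0 + c%:C * g1), z.
split; [rewrite E0E adjB|rewrite E1E adjD]; rewrite !adj_scale !conjc_real.
  by rewrite mulmxBl -!scalemxAl eE eF !scalerA scalerBl.
by rewrite mulmxDl -!scalemxAl eE eF !scalerA scalerDl.
Qed.

(** * Coordinates and Schmidt ranks *)

Definition coord n m (g : 'I_m -> 'I_n) : 'M[C]_(n, m) :=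
  \matrix_(a, l) (a == g l)%:R.

Lemma adj_coord_mul n m p (g : 'I_m -> 'I_n) (X : 'M[C]_(n, p)) l b :
  (adj (coord g) *m X) l b = X (g l) b.
Proof.
rewrite mxE (bigD1 (g l)) //= big1 ?addr0 => [|a /negPf ne].
  by rewrite !mxE eqxx rmorph1 mul1r.
by rewrite !mxE ne rmorph0 mul0r.
Qed.

Lemma mul_coord n m p (g : 'I_m -> 'I_n) (X : 'M[C]_(p, n)) a l :
  (X *m coord g) a l = X a (g l).
Proof.
rewrite mxE (bigD1 (g l)) //= big1 ?addr0 => [|b /negPf ne].
  by rewrite !mxE eqxx mulr1.
by rewrite !mxE ne mulr0.
Qed.

Lemma sform_coord n m p (g : 'I_m -> 'I_n) (h : 'I_p -> 'I_n) X z z' :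
  sform X (coord g *m z) (coord h *m z') = sform (mxsub g h X) z z'.
Proof.
rewrite -sform_mul; congr sform; apply/matrixP => l k.
by rewrite mul_coord adj_coord_mul mxE.
Qed.

Lemma coord_orth n m (g h : 'I_m -> 'I_n) :
  adj (coord g) *m coord h = \matrix_(l, k) (g l == h k)%:R.
Proof. by apply/matrixP => l k; rewrite adj_coord_mul !mxE. Qed.

Lemma coord_iso n m (g : 'I_m -> 'I_n) : injective g ->
  adj (coord g) *m coord g = 1%:M.
Proof.
by move=> gI; rewrite coord_orth; apply/matrixP => l k; rewrite !mxE (inj_eq gI).
Qed.

Lemma coord_disjoint n m (g h : 'I_m -> 'I_n) : (forall l k, g l != h k) ->
  adj (coord g) *m coord h = 0.
Proof.
by move=> gh; rewrite coord_orth; apply/matrixP => l k; rewrite !mxE (negPf (gh _ _)).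
Qed.

Lemma combo_mul n m (E0 E1 : 'M[C]_(n, m)) c s (z : 'cV[C]_m) :
  combo E0 E1 c s *m z = c%:C *: (E0 *m z) + s%:C *: (E1 *m z).
Proof. by rewrite mulmxDl -!scalemxAl. Qed.

Lemma sform_combo n m (X : 'M[C]_n) (E0 E1 : 'M[C]_(n, m)) a b c d z z' :
  sform X (combo E0 E1 a b *m z) (combo E0 E1 c d *m z') =
  (a * c)%:C * sform X (E0 *m z) (E0 *m z') +
  (a * d)%:C * sform X (E0 *m z) (E1 *m z') +
  (b * c)%:C * sform X (E1 *m z) (E0 *m z') +
  (b * d)%:C * sform X (E1 *m z) (E1 *m z').
Proof.
rewrite !combo_mul !(sformDl, sformDr, sformZl, sformZr) !conjc_real !rmorphM.
ring.
Qed.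

(** * Partial transposes tested on pairs of blocks *)

Definition conjv m (z : 'cV[C]_m) : 'cV[C]_m := \col_i conjc (z i 0).

Lemma conjvK m : involutive (@conjv m).
Proof. by move=> z; apply/matrixP => i j; rewrite !mxE conjcK ord1. Qed.

Lemma sformE m n (X : 'M[C]_(m, n)) x y :
  sform X x y = \sum_i \sum_j conjc (x i 0) * X i j * y j 0.
Proof.
rewrite /sform ipE; apply: eq_bigr => i _; rewrite mxE mulr_sumr.
by apply: eq_bigr => j _; rewrite mulrA.
Qed.

Lemma sform_tr m (X : 'M[C]_m) z z' : sform X^T z z' = sform X (conjv z') (conjv z).
Proof.
rewrite !sformE exchange_big; apply: eq_bigr => i _; apply: eq_bigr => j _.
by rewrite !mxE conjcK; ring.
Qed.

(** Expand the form of [tau] at [p + q]: the cross terms are conjugate to each other in [sigma] and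
    add up to twice a real part. Here [tau] stands for the partial transpose of [sigma]. *)
Lemma qf_pt_ge0 n (sigma tau : 'M[C]_n) p q a b c d :
  adj sigma = sigma -> psd tau ->
  sform tau p p = sform sigma a a -> sform tau q q = sform sigma b b ->
  sform tau p q + sform tau q p = sform sigma c d + sform sigma d c ->
  0 <= qf sigma a + qf sigma b + 2 * Re (sform sigma c d).
Proof.
move=> hs /psdP[_ pt] ea eb ec; have := pt (p + q).
have ed : sform sigma d c = conjc (sform sigma c d) by rewrite sformJ hs.
have -> : qf tau (p + q) = Re (sform sigma a a + sform sigma b b +
    (sform sigma c d + sform sigma d c)).
  by rewrite -ec -ea -eb /qf sformDl !sformDr; congr Re; ring.
by rewrite ed !cReD cReJ mulr2n mulrDl mul1r.
Qed.

Section Swap.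
Variables (n m : nat) (sigma tau : 'M[C]_n) (E0 E1 : 'M[C]_(n, m)).
Hypotheses (hs : adj sigma = sigma) (ptau : psd tau).
Let E b := if b then E1 else E0.

(** For blocks indexed by the first factor, partial transposition transposes each block in place,
    which exchanges and conjugates the inner vectors; hence the test vectors are built from
    [conjv z0] and [conjv z1]. *)
Lemma pt_test_row :
  (forall b b' z z', sform tau (E b *m z) (E b' *m z') =
     sform sigma (E b *m conjv z') (E b' *m conjv z)) ->
  forall c s c' s' z0 z1,
  0 <= qf sigma (combo E0 E1 c s *m z0) + qf sigma (combo E0 E1 c' s' *m z1) +
       2 * Re (sform sigma (combo E0 E1 c s *m z1) (combo E0 E1 c' s' *m z0)).
Proof.
move=> h c s c' s' z0 z1.
have hc a b a' b' z z' :
    sform tau (combo E0 E1 a b *m z) (combo E0 E1 a' b' *m z') =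
    sform sigma (combo E0 E1 a b *m conjv z') (combo E0 E1 a' b' *m conjv z).
  rewrite !sform_combo (h false false) (h false true) (h true false) (h true true).
  by [].
have hc' a b a' b' z z' :
    sform tau (combo E0 E1 a b *m conjv z) (combo E0 E1 a' b' *m conjv z') =
    sform sigma (combo E0 E1 a b *m z') (combo E0 E1 a' b' *m z).
  by rewrite hc !conjvK.
exact: (@qf_pt_ge0 _ _ _ _ _ (combo E0 E1 c s *m z0) (combo E0 E1 c' s' *m z1)
  (combo E0 E1 c s *m z1) (combo E0 E1 c' s' *m z0) hs ptau
  (hc' c s c s z0 z0) (hc' c' s' c' s' z1 z1)
  (congr2 +%R (hc' c s c' s' z0 z1) (hc' c' s' c s z1 z0))).
Qed.

(** For blocks indexed by the second factor, partial transposition exchanges the block labels and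
    leaves the inner vectors alone. This passes to rotated pairs because their coefficients are
    real. *)
Lemma pt_test_col :
  (forall b b' z z', sform tau (E b *m z) (E b' *m z') =
     sform sigma (E b' *m z) (E b *m z')) ->
  forall c s c' s' z0 z1,
  0 <= qf sigma (combo E0 E1 c s *m z0) + qf sigma (combo E0 E1 c' s' *m z1) +
       2 * Re (sform sigma (combo E0 E1 c s *m z1) (combo E0 E1 c' s' *m z0)).
Proof.
move=> h c s c' s' z0 z1.
have hc a b a' b' z z' :
    sform tau (combo E0 E1 a b *m z) (combo E0 E1 a' b' *m z') =
    sform sigma (combo E0 E1 a' b' *m z) (combo E0 E1 a b *m z').
  rewrite !sform_combo (h false false) (h false true) (h true false) (h true true) /=.
  by rewrite !(mulrC a) !(mulrC b); ring.
exact: (@qf_pt_ge0 _ _ _ _ _ (combo E0 E1 c s *m z0) (combo E0 E1 c' s' *m z1)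
  (combo E0 E1 c s *m z1) (combo E0 E1 c' s' *m z0) hs ptau
  (hc c s c s z0 z0) (hc c' s' c' s' z1 z1)
  (etrans (congr2 +%R (hc c s c' s' z0 z1) (hc c' s' c s z1 z0)) (addrC _ _))).
Qed.

End Swap.

Lemma mxvec_index_eq d1 d2 (i k : 'I_d1) (j l : 'I_d2) :
  (mxvec_index i j == mxvec_index k l) = (i == k) && (j == l).
Proof.
by rewrite (inj_eq (@cast_ord_inj _ _ _)) (inj_eq enum_rank_inj) xpair_eqE.
Qed.

Lemma ptransE d1 d2 (sigma : 'M[C]_(d1 * d2)) i j k l :
  ptrans sigma (mxvec_index i j) (mxvec_index k l) =
  sigma (mxvec_index i l) (mxvec_index k j).
Proof.
have off i' j' k' l' : [|| i' != i, j' != j, k' != k | l' != l] ->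
    ((mxvec_index i j == mxvec_index i' j') &&
     (mxvec_index k l == mxvec_index k' l'))%:R *
    sigma (mxvec_index i' l') (mxvec_index k' j') = 0.
  rewrite !mxvec_index_eq (eq_sym i) (eq_sym j) (eq_sym k) (eq_sym l).
  by case/or4P => /negPf ->; rewrite ?andbF mul0r.
rewrite mxE (bigD1 i) //= (bigD1 j) //= (bigD1 k) //= (bigD1 l) //=.
rewrite !big1 => [|x ne|x ne|x ne|x ne]; do ?[apply: big1 => ? _];
  do ?by apply: off; rewrite ne ?orbT.
by rewrite !addr0 !eqxx mul1r.
Qed.

(** With [M = vec_mx psi^T] the coefficient matrix, the reduced operator is [M^T] times the
    entrywise conjugate of [M]. *)
Lemma schmidt_rank_le d1 d2 (psi : 'cV[C]_(d1 * d2)) :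
  (schmidt_rank psi <= \rank (vec_mx psi^T))%N.
Proof.
rewrite /schmidt_rank; have -> : ptraceA (proj psi) =
    (vec_mx psi^T)^T *m \matrix_(i, j) conjc (vec_mx psi^T i j).
  apply/matrixP => j l; rewrite !mxE; apply: eq_bigr => i _.
  by rewrite !mxE big_ord1 !mxE.
by rewrite -[X in (_ <= X)%N]mxrank_tr; exact: mxrankM_maxl.
Qed.

(** The rows [i0] and [i1] satisfy a linear relation with coefficients [g1] and [- g0]; if [g0 = 0]
    this may be trivial, but then row [i0] is itself zero. *)
Lemma rank_parallel_rows p q (M : 'M[C]_(p, q)) i0 i1 (g0 g1 : C) (z : 'rV[C]_q) :
  i0 != i1 -> row i0 M = g0 *: z -> row i1 M = g1 *: z -> (\rank M < p)%N.
Proof.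
move=> ne r0 r1; rewrite ltn_neqAle rank_leq_row andbT; apply/negP => free.
have kill (a : 'rV[C]_p) : a *m M = 0 -> a = 0.
  by move=> aM; apply: (row_free_inj free); rewrite aM mul0mx.
have dM i : (delta_mx 0 i : 'rV_p) *m M = row i M by rewrite rowE.
have [g00|g00] := eqVneq g0 0.
  have /kill/matrixP/(_ 0 i0) : (delta_mx 0 i0 : 'rV_p) *m M = 0.
    by rewrite dM r0 g00 scale0r.
  by rewrite !mxE !eqxx => /eqP; rewrite oner_eq0.
have /kill/matrixP/(_ 0 i1) :
    (g1 *: (delta_mx 0 i0 : 'rV_p) - g0 *: (delta_mx 0 i1 : 'rV_p)) *m M = 0.
  by rewrite mulmxBl -!scalemxAl !dM r0 r1 !scalerA mulrC subrr.
rewrite !mxE !eqxx (eq_sym i1) (negPf ne) mulr0 mulr1 add0r => /eqP.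
by rewrite oppr_eq0 (negPf g00).
Qed.

(** Zero kets are dropped and the others normalised; their squared norms become the weights, which
    sum to the trace of [rho]. *)
Lemma SN_le_of_mixof d1 d2 (P : 'cV[C]_(d1 * d2) -> Prop) rho k :
  (forall c u, P u -> P (c *: u)) ->
  (forall u, P u -> (schmidt_rank u <= k)%N) ->
  mixof P rho -> \tr rho = 1 -> SN_le rho k.
Proof.
move=> PZ Pk [s [-> hs]] htr.
pose r := [seq u <- s | u != 0].
have rE : \sum_(u <- s) proj u = \sum_(u <- r) proj u.
  rewrite big_filter [LHS](bigID (fun u => u != 0)) /= addrC big1 ?add0r //.
  by move=> u /negPn/eqP ->; rewrite /proj mul0mx.
have hr u : u \in r -> 0 < nrm u /\ P u.
  by rewrite mem_filter => /andP[u0 us]; split; [exact: nrm_gt0|exact: hs].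
have nz (t : 'I_(size r)) : 0 < nrm r`_t /\ P r`_t by apply/hr/mem_nth.
have nr (a : R) : nsq a%:C = a ^+ 2 by rewrite /nsq /= expr0n addr0.
have tr_proj u : \tr (proj u : 'M[C]_(d1 * d2)) = (nrm u)%:C.
  by rewrite /proj mxtrace_mulC /mxtrace big_ord1 -ip_nrm.
exists (size r), (fun t => nrm r`_t), (fun t => (Num.sqrt (nrm r`_t))^-1%:C *: r`_t).
split=> [t||t||t].
- exact: nrm_ge0.
- apply: complexI; rewrite rmorph1 -htr rE (big_nth 0) big_mkord rmorph_sum.
  by rewrite [\tr _]raddf_sum; apply: eq_bigr => t _; rewrite [RHS]tr_proj.
- have [n0 _] := nz t; rewrite -/(ip _ _) ip_nrm nrmZ nr exprVn.
  by rewrite sqr_sqrtr ?ltW // mulVf ?gt_eqF // rmorph1.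
- rewrite rE (big_nth 0) big_mkord; apply: eq_bigr => t _; have [n0 _] := nz t.
  rewrite projZ scalerA -rmorphM nr exprVn sqr_sqrtr ?ltW // divff ?gt_eqF //.
  by rewrite scale1r.
- by have [_ h] := nz t; apply/Pk/PZ.
Qed.

Lemma parallel_rowsZ n m (E0 E1 : 'M[C]_(n, m)) c u :
  parallel_rows E0 E1 u -> parallel_rows E0 E1 (c *: u).
Proof.
move=> [g0 [g1 [z [h0 h1]]]]; exists (c * g0), (c * g1), z.
by rewrite -!scalemxAr h0 h1 !scalerA.
Qed.

(** The slices at two basis vectors of the first factor are rows of the coefficient matrix, and
    making two of its [d1.+2] rows parallel costs one unit of rank. *)
Lemma SN_le_rows d1 d2 (rho : 'M[C]_(d1.+2 * d2.+1)) :
  is_state rho -> absolutely_PPT rho -> SN_le rho d1.+1.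
Proof.
move=> [prho tr1] happt.
pose g (i : 'I_d1.+2) (j : 'I_d2.+1) := mxvec_index i j.
pose i1 : 'I_d1.+2 := lift ord0 ord0.
have gI i : injective (g i).
  by move=> j l /eqP; rewrite mxvec_index_eq eqxx => /eqP.
apply: (@SN_le_of_mixof _ _ (parallel_rows (coord (g ord0)) (coord (g i1)))) => //.
- by move=> c u; exact: parallel_rowsZ.
- move=> u [g0 [g1 [z [h0 h1]]]]; apply: leq_trans (schmidt_rank_le u) _.
  rewrite -ltnS; apply: (@rank_parallel_rows _ _ _ ord0 i1 g0 g1 z^T) => //;
    apply/matrixP => a j; rewrite ord1.
    by have /matrixP/(_ j 0) := h0; rewrite adj_coord_mul !mxE.
  by have /matrixP/(_ j 0) := h1; rewrite adj_coord_mul !mxE.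
apply: mixof_parallel => //; try exact: coord_iso.
  by apply: coord_disjoint => l k; rewrite mxvec_index_eq.
move=> c s cs U hU z0 z1 /=.
have hs : adj (U *m rho *m adj U) = U *m rho *m adj U.
  by have [hr _] := prho; rewrite !adjM adjK hr mulmxA.
apply: (pt_test_row hs (happt U hU)) => b b' z z'.
have key i k :
  sform (ptrans (U *m rho *m adj U)) (coord (g i) *m z) (coord (g k) *m z') =
  sform (U *m rho *m adj U) (coord (g i) *m conjv z') (coord (g k) *m conjv z).
  rewrite !sform_coord -sform_tr; congr sform; apply/matrixP => j l.
  by rewrite [LHS]mxE ptransE [RHS]mxE [RHS]mxE.
by case: b; case: b'; exact: key.
Qed.

(** The mirror image for the second factor: the slices are columns, hence rows of the transposed
    coefficient matrix, and positivity of the partial transpose enters through [pt_test_col]. *)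
Lemma SN_le_cols d1 d2 (rho : 'M[C]_(d1.+1 * d2.+2)) :
  is_state rho -> absolutely_PPT rho -> SN_le rho d2.+1.
Proof.
move=> [prho tr1] happt.
pose g (j : 'I_d2.+2) (i : 'I_d1.+1) := mxvec_index i j.
pose j1 : 'I_d2.+2 := lift ord0 ord0.
have gI j : injective (g j).
  by move=> i k /eqP; rewrite mxvec_index_eq eqxx andbT => /eqP.
apply: (@SN_le_of_mixof _ _ (parallel_rows (coord (g ord0)) (coord (g j1)))) => //.
- by move=> c u; exact: parallel_rowsZ.
- move=> u [g0 [g1 [z [h0 h1]]]]; apply: leq_trans (schmidt_rank_le u) _.
  rewrite -ltnS -mxrank_tr; apply: (@rank_parallel_rows _ _ _ ord0 j1 g0 g1 z^T) => //;
    apply/matrixP => a i; rewrite ord1.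
    by have /matrixP/(_ i 0) := h0; rewrite adj_coord_mul !mxE.
  by have /matrixP/(_ i 0) := h1; rewrite adj_coord_mul !mxE.
apply: mixof_parallel => //; try exact: coord_iso.
  by apply: coord_disjoint => l k; rewrite mxvec_index_eq andbF.
move=> c s cs U hU z0 z1 /=.
have hs : adj (U *m rho *m adj U) = U *m rho *m adj U.
  by have [hr _] := prho; rewrite !adjM adjK hr mulmxA.
apply: (pt_test_col hs (happt U hU)) => b b' z z'.
have key j l :
  sform (ptrans (U *m rho *m adj U)) (coord (g j) *m z) (coord (g l) *m z') =
  sform (U *m rho *m adj U) (coord (g l) *m z) (coord (g j) *m z').
  rewrite !sform_coord; congr sform; apply/matrixP => i k.
  by rewrite [LHS]mxE ptransE [RHS]mxE.
by case: b; case: b'; exact: key.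
Qed.

End AbsolutelyPPT.


Theorem theorem21 (R : realType) (d1 d2 : nat) (rho : 'M[R[i]]_(d1 * d2)) :
  (2 <= d1)%N -> (2 <= d2)%N ->
  is_state rho -> absolutely_PPT rho ->
  SN_le rho (minn d1 d2).-1.
Proof.
case: d1 rho => [|[|d1]] //; case: d2 => [|[|d2]] // rho _ _ hst happt.
(* The two parallel slices are taken in the smaller factor. *)
case: leqP => _; first exact: SN_le_rows.
exact: SN_le_cols.
Qed.
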